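(* Let $d=2$ and consider a sensor network with at least three anchors $a_1,\dots,a_m\in\mathbb{R}^2$ and $n$ sensors with true locations $x_1,\dots,x_n\in\mathbb{R}^2$, whose graph (on the set of all anchors and sensors) is a generic triangulation graph. Let $E$ and $\bar E$ be the sets of sensor-sensor and anchor-sensor edges, with known Euclidean edge lengths $d_{ij}$ and $\bar d_{kj}$ respectively, and let $E_v$ and $\bar E_v$ be the sets of sensor-sensor and anchor-sensor virtual edges. Consider the SDP $$\begin{array}{ll}\text{maximize} & \sum_{(k,j)\in\bar E_v}\bar A_{kj}\bullet Z+\sum_{(i,j)\in E_v}A_{ij}\bullet Z\\ \text{subject to}& Z_{(1:d,1:d)}=I_d,\\ & A_{ij}\bullet Z=d_{ij}^2\quad\forall (i,j)\in E,\\ & \bar A_{kj}\bullet Z=\bar d_{kj}^2\quad\forall (k,j)\in\bar E,\\ & Z\succeq 0,\end{array}\qquad(\mathrm P)$$ over symmetric $Z\in\mathbb{R}^{(d+n)\times(d+n)}$, and its dual $$\begin{array}{ll}\text{minimize} & I_d\bullet V+\sum_{(i,j)\in E}y_{ij}d_{ij}^2+\sum_{(k,j)\in\bar E}w_{kj}\bar d_{kj}^2\\ \text{subject to} & U=\begin{pmatrix}V&0\\ 0&0\end{pmatrix}+\sum_{(i,j)\in E}y_{ij}A_{ij}+\sum_{(k,j)\in\bar E}w_{kj}\bar A_{kj}-\sum_{(k,j)\in\bar E_v}\bar A_{kj}-\sum_{(i,j)\in E_v}A_{ij},\\ & U\succeq 0,\end{array}\qquad(\mathrm D)$$ over symmetric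 $V\in\mathbb{R}^{d\times d}$ and real $y_{ij},w_{kj}$. Then there is an optimal dual slack matrix $U$ of $(\mathrm D)$ of rank $n$, and the optimal solution $Z$ of $(\mathrm P)$ has rank $d=2$, so that the pair $(Z,U)$ is strictly complementary and the SDP relaxation $(\mathrm P)$ produces the correct localization, i.e. the optimal solution of $(\mathrm P)$ is $Z=\begin{pmatrix}I_d & X\\ X^T & X^T X\end{pmatrix}$ with $X=[x_1\ \cdots\ x_n]$ the matrix of true sensor locations.
   Context: Notation: $e_i\in\mathbb{R}^n$ is the $i$-th standard basis vector; $(u;v)$ denotes the vertical concatenation of column vectors; $A_{ij}=(\mathbf 0;e_i-e_j)(\mathbf 0;e_i-e_j)^T$ with $\mathbf 0\in\mathbb{R}^d$, and $\bar A_{kj}=(a_k;-e_j)(a_k;-e_j)^T$; $A\bullet B=\sum_{i,j}A_{ij}B_{ij}$; $Z_{(1:d,1:d)}$ is the upper-left $d\times d$ principal submatrix of $Z$; $Z\succeq0$ means symmetric positive semidefinite. A triangulation $\mathcal{T}_{\mathcal P}$ of a finite set $\mathcal P\subset\mathbb{R}^2$ is a subdivision of the convex hull of $\mathcal P$ into triangles with vertices in $\mathcal P$, such that triangles do not overlap (their edges do not cross) and no triangle lies strictly inside another. The triangulation graph has vertex set $\mathcal P$, and $(p_i,p_j)$ is an edge if and only if it is an edge of a triangle in $\mathcal{T}_{\mathcal P}$. Here $\mathcal P$ is the set of all anchors and sensors at their true locations; ''generic'' refers to the positions of these points (the paper uses the term in its standard sense without defining it). Two triangles of the triangulation are adjacent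 if they share a common edge. A virtual edge exists between points $i$ and $j$ when $i$ and $j$ belong to adjacent triangles but $(i,j)$ is not an edge of the graph. A pair of optimal solutions $Z$ of (P) and $U$ of (D) is strictly complementary if $ZU=0$ and $\operatorname{rank}(Z)+\operatorname{rank}(U)=d+n$.
   Formalization: Every anchor and sensor is required to be a vertex of some triangle of the triangulation (otherwise a sensor inside a triangle could be isolated in the graph and the claim fails); ''generic'' is taken to mean that the coordinates of all points are algebraically independent over the rationals. *)

(* Defs.v *)
From HB Require Import structures.
From mathcomp Require Import all_boot all_order all_algebra reals.
From mathcomp Require Import mpoly.

Set Implicit Arguments.
Unset Strict Implicit.
Unset Printing Implicit Defensive.

Import Order.TTheory GRing.Theory Num.Theory.

Local Open Scope ring_scope.

(* A configuration of N labelled points of R^d is a d x N matrix whose k-th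
   column is the k-th point. *)

(* Genericity in the sense of rigidity theory: the d * N coordinates are
   algebraically independent over the rationals. *)
Definition generic (R : realType) (d N : nat) (p : 'M[R]_(d, N)) : Prop :=
  forall q : {mpoly rat[d * N]},
    (map_mpoly ratr q).@[mxvec p 0] = 0 -> q = 0.

(* The convex hull of the points labelled by S. *)
Definition in_hull (R : realType) (d N : nat) (p : 'M[R]_(d, N))
    (S : {set 'I_N}) (z : 'cV[R]_d) : Prop :=
  exists c : 'I_N -> R,
    [/\ forall i, i \in S -> 0 <= c i,
        \sum_(i in S) c i = 1
      & z = \sum_(i in S) c i *: col i p].

(* The relative interior of that hull: for three affinely independent points of
   the plane, the interior of the triangle; for two points, the open segment. *)
Definition in_relint (R : realType) (d N : nat) (p : 'M[R]_(d, N))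
    (S : {set 'I_N}) (z : 'cV[R]_d) : Prop :=
  exists c : 'I_N -> R,
    [/\ forall i, i \in S -> 0 < c i,
        \sum_(i in S) c i = 1
      & z = \sum_(i in S) c i *: col i p].

Definition affinely_independent (R : realType) (d N : nat) (p : 'M[R]_(d, N))
    (S : {set 'I_N}) : Prop :=
  forall c : 'I_N -> R,
    \sum_(i in S) c i = 0 -> \sum_(i in S) c i *: col i p = 0 ->
    forall i, i \in S -> c i = 0.

Definition tri_edge (N : nat) (T : {set {set 'I_N}}) : rel 'I_N :=
  fun i j => (i != j) && [exists t in T, (i \in t) && (j \in t)].

(* A triangle is represented by the set of labels of its three vertices. *)
Record is_triangulation (R : realType) (N : nat) (p : 'M[R]_(2, N))
    (T : {set {set 'I_N}}) : Prop := IsTriangulation {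
  tri_card : forall t, t \in T -> #|t| = 3%N;
  tri_nondegenerate : forall t, t \in T -> affinely_independent p t;
  (* without this an unused point inside a triangle would be an isolated vertex
     of the graph *)
  tri_vertex : forall i, exists2 t, t \in T & i \in t;
  tri_cover : forall z,
    in_hull p [set: 'I_N] z <-> exists2 t, t \in T & in_hull p t z;
  tri_no_overlap : forall s t, s \in T -> t \in T -> s != t ->
    forall z, in_relint p s z -> ~ in_relint p t z;
  tri_no_crossing : forall i j k l, tri_edge T i j -> tri_edge T k l ->
    [set i; j] != [set k; l] ->
    forall z, in_relint p [set i; j] z -> ~ in_relint p [set k; l] z;
  tri_no_nesting : forall s t, s \in T -> t \in T -> s != t ->
    ~ (forall z, in_hull p s z -> in_hull p t z)
}.

(* Two triangles share an edge when they have exactly two common vertices. *)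
Definition tri_adjacent (N : nat) (s t : {set 'I_N}) : bool :=
  #|s :&: t| == 2%N.

Definition virtual_edge (N : nat) (T : {set {set 'I_N}}) : rel 'I_N :=
  fun i j => [&& i != j, ~~ tri_edge T i j &
    [exists s in T, exists t in T,
       [&& tri_adjacent s t, i \in s & j \in t]]].

(* The data of (P) and (D).  A sensor-sensor pair, being unordered, is meant to
   be listed once, as (i, j) with i < j. *)
Record snl (R : realType) (d m n : nat) := Snl {
  anchors : 'M[R]_(d, m);
  ss_edges : {set 'I_n * 'I_n};
  as_edges : {set 'I_m * 'I_n};
  ss_dist : 'I_n -> 'I_n -> R;
  as_dist : 'I_m -> 'I_n -> R;
  ss_virtual : {set 'I_n * 'I_n};
  as_virtual : {set 'I_m * 'I_n}
}.

Definition edist (R : realType) (d : nat) (u v : 'cV[R]_d) : R :=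
  Num.sqrt (\sum_i (u i 0 - v i 0) ^+ 2).

(* In the configuration [row_mx a x] the label of anchor k is [lshift n k] and
   that of sensor j is [rshift m j]. *)
Definition triangulation_snl (R : realType) (m n : nat)
    (a : 'M[R]_(2, m)) (x : 'M[R]_(2, n)) (T : {set {set 'I_(m + n)}}) :
    snl R 2 m n :=
  {| anchors := a;
     ss_edges := [set ij : 'I_n * 'I_n | (ij.1 < ij.2)%N &
                    tri_edge T (rshift m ij.1) (rshift m ij.2)];
     as_edges := [set kj : 'I_m * 'I_n |
                    tri_edge T (lshift n kj.1) (rshift m kj.2)];
     ss_dist := fun i j => edist (col i x) (col j x);
     as_dist := fun k j => edist (col k a) (col j x);
     ss_virtual := [set ij : 'I_n * 'I_n | (ij.1 < ij.2)%N &
                      virtual_edge T (rshift m ij.1) (rshift m ij.2)];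
     as_virtual := [set kj : 'I_m * 'I_n |
                      virtual_edge T (lshift n kj.1) (rshift m kj.2)] |}.

Definition mxdot (R : realType) (p q : nat) (A B : 'M[R]_(p, q)) : R :=
  \sum_i \sum_j A i j * B i j.

Definition psd (R : realType) (N : nat) (A : 'M[R]_N) : Prop :=
  A^T = A /\ forall v : 'cV[R]_N, 0 <= (v^T *m A *m v) 0 0.

Definition ss_vec (R : realType) (d n : nat) (i j : 'I_n) : 'cV[R]_(d + n) :=
  col_mx 0 (delta_mx i 0 - delta_mx j 0).

Definition as_vec (R : realType) (d m n : nat) (a : 'M[R]_(d, m))
    (k : 'I_m) (j : 'I_n) : 'cV[R]_(d + n) :=
  col_mx (col k a) (- delta_mx j 0).

Definition ss_mx (R : realType) (d n : nat) (i j : 'I_n) : 'M[R]_(d + n) :=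
  ss_vec R d i j *m (ss_vec R d i j)^T.

Definition as_mx (R : realType) (d m n : nat) (a : 'M[R]_(d, m))
    (k : 'I_m) (j : 'I_n) : 'M[R]_(d + n) :=
  as_vec a k j *m (as_vec a k j)^T.

Section SDP.

Context (R : realType) (d m n : nat) (G : snl R d m n).

Definition primal_obj (Z : 'M[R]_(d + n)) : R :=
  \sum_(kj in as_virtual G) mxdot (as_mx (anchors G) kj.1 kj.2) Z
  + \sum_(ij in ss_virtual G) mxdot (ss_mx R d ij.1 ij.2) Z.

Definition primal_feasible (Z : 'M[R]_(d + n)) : Prop :=
  [/\ ulsubmx Z = 1%:M,
      forall i j, (i, j) \in ss_edges G ->
        mxdot (ss_mx R d i j) Z = ss_dist G i j ^+ 2,
      forall k j, (k, j) \in as_edges G ->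
        mxdot (as_mx (anchors G) k j) Z = as_dist G k j ^+ 2
    & psd Z].

Definition primal_optimal (Z : 'M[R]_(d + n)) : Prop :=
  primal_feasible Z /\
  forall Z', primal_feasible Z' -> primal_obj Z' <= primal_obj Z.

(* The multipliers y and w are total matrices; only their entries at (listed)
   edges are used. *)
Definition dual_obj (V : 'M[R]_d) (y : 'M[R]_n) (w : 'M[R]_(m, n)) : R :=
  mxdot 1%:M V
  + \sum_(ij in ss_edges G) y ij.1 ij.2 * ss_dist G ij.1 ij.2 ^+ 2
  + \sum_(kj in as_edges G) w kj.1 kj.2 * as_dist G kj.1 kj.2 ^+ 2.

Definition dual_slack (V : 'M[R]_d) (y : 'M[R]_n) (w : 'M[R]_(m, n)) :
    'M[R]_(d + n) :=
  block_mx V 0 0 0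
  + \sum_(ij in ss_edges G) y ij.1 ij.2 *: ss_mx R d ij.1 ij.2
  + \sum_(kj in as_edges G) w kj.1 kj.2 *: as_mx (anchors G) kj.1 kj.2
  - \sum_(kj in as_virtual G) as_mx (anchors G) kj.1 kj.2
  - \sum_(ij in ss_virtual G) ss_mx R d ij.1 ij.2.

Definition dual_feasible (V : 'M[R]_d) (y : 'M[R]_n) (w : 'M[R]_(m, n)) :
    Prop :=
  V^T = V /\ psd (dual_slack V y w).

Definition dual_optimal (V : 'M[R]_d) (y : 'M[R]_n) (w : 'M[R]_(m, n)) :
    Prop :=
  dual_feasible V y w /\
  forall V' y' w', dual_feasible V' y' w' -> dual_obj V y w <= dual_obj V' y' w'.

Definition dual_optimal_slack (U : 'M[R]_(d + n)) : Prop :=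
  exists V y w, dual_optimal V y w /\ U = dual_slack V y w.

Definition strictly_complementary (Z U : 'M[R]_(d + n)) : Prop :=
  [/\ primal_optimal Z, dual_optimal_slack U, Z *m U = 0
    & (\rank Z + \rank U)%N = (d + n)%N].

End SDP.

(* Main.v *)
Require Import Defs.
From HB Require Import structures.
From mathcomp Require Import all_boot all_order all_algebra reals.
From mathcomp Require Import mpoly.
From mathcomp Require Import ring lra zify.

Set Implicit Arguments.
Unset Strict Implicit.
Unset Printing Implicit Defensive.

Import Order.TTheory GRing.Theory Num.Theory.

Local Open Scope ring_scope.

(* Two adjacent triangles have four vertices, whose affine dependence c gives the
   positive semidefinite stress matrix c^T c.  Since the two apexes lie on
   opposite sides of the common edge, c has the same sign at both, so the entry
   of c^T c at the apex pair is positive.  A suitable positive combination W of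
   these rank-one matrices has entry 1 at every virtual edge and 0 at every other
   non-edge, and therefore defines a dual slack matrix U.  A vector in the kernel
   of W is affine on each triangle, with the same affine function on adjacent
   triangles; as any two triangles are joined by a chain of adjacent ones, it is
   globally affine.  Genericity makes the anchors affinely independent, which
   cuts the kernel of U down to the row space of (I X).  Zero duality gap at
   Z = (I X)^T (I X) and U Z' = 0 for every primal optimal Z' do the rest. *)

(** * Homogeneous barycentric coordinates *)

Section Barycentric.

Context (R : realType) (N : nat) (p : 'M[R]_(2, N)).

(* Row [i] holds the homogeneous coordinates [(1, p_i)]. *)
Definition lift_mx : 'M[R]_(N, 1 + 2) := row_mx (const_mx 1) p^T.

Definition lift_pt (z : 'cV[R]_2) : 'rV[R]_(1 + 2) := row_mx 1 z^T.

(** Weights on [S] are extended by zero to all labels, so that combinations of the points of [S]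
    become products with [lift_mx]. *)
Definition supported (S : {set 'I_N}) (u : 'rV[R]_N) : Prop :=
  forall i, i \notin S -> u 0 i = 0.

Lemma supported_sum (V : lmodType R) (S : {set 'I_N}) (u : 'rV[R]_N)
    (F : 'I_N -> V) :
  supported S u -> \sum_i u 0 i *: F i = \sum_(i in S) u 0 i *: F i.
Proof.
move=> uS; rewrite [RHS]big_mkcond /=; apply: eq_bigr => i _.
by case: ifPn => // /uS ->; rewrite scale0r.
Qed.

Lemma mul_lift_mx (u : 'rV[R]_N) :
  u *m lift_mx = row_mx (\sum_i u 0 i)%:M (\sum_i u 0 i *: col i p)^T.
Proof.
rewrite mul_mx_row; congr row_mx; apply/rowP => j.
  by rewrite !mxE ord1 eqxx mulr1n; apply: eq_bigr => i _; rewrite mxE mulr1.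
rewrite !mxE summxE; apply: eq_bigr => i _.
by rewrite !mxE.
Qed.

Lemma mul_lift_mx_pt (u : 'rV[R]_N) z :
  u *m lift_mx = lift_pt z <->
  \sum_i u 0 i = 1 /\ z = \sum_i u 0 i *: col i p.
Proof.
rewrite mul_lift_mx /lift_pt;
  split=> [/eq_row_mx [/rowP/(_ 0) + /trmx_inj ->]|[-> <-] //].
by rewrite !mxE /= !mulr1n.
Qed.

Lemma in_hullP S z :
  in_hull p S z <->
  exists u, [/\ supported S u, forall i, 0 <= u 0 i & u *m lift_mx = lift_pt z].
Proof.
split=> [[c [c0 c1 cz]]|[u [uS u0 /mul_lift_mx_pt[u1 uz]]]].
  exists (\row_i if i \in S then c i else 0); split.
  - by move=> i iS; rewrite mxE (negbTE iS).
  - by move=> i; rewrite mxE; case: ifP => // /c0.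
  - apply/mul_lift_mx_pt; split.
      by rewrite -c1 [RHS]big_mkcond; apply: eq_bigr => i _; rewrite mxE.
    rewrite cz [LHS]big_mkcond; apply: eq_bigr => i _; rewrite mxE.
    by case: ifP; rewrite ?scale0r.
exists (fun i => u 0 i); split=> [i _ //||].
  rewrite -u1 [LHS]big_mkcond; apply: eq_bigr => i _.
  by case: ifPn => // /uS.
by rewrite uz (supported_sum _ uS).
Qed.

Lemma in_relintP S z :
  in_relint p S z <->
  exists u, [/\ supported S u, forall i, i \in S -> 0 < u 0 i
              & u *m lift_mx = lift_pt z].
Proof.
split=> [[c [c0 c1 cz]]|[u [uS u0 /mul_lift_mx_pt[u1 uz]]]].
  exists (\row_i if i \in S then c i else 0); split.
  - by move=> i iS; rewrite mxE (negbTE iS).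
  - by move=> i iS; rewrite mxE iS; apply: c0.
  - apply/mul_lift_mx_pt; split.
      by rewrite -c1 [RHS]big_mkcond; apply: eq_bigr => i _; rewrite mxE.
    rewrite cz [LHS]big_mkcond; apply: eq_bigr => i _; rewrite mxE.
    by case: ifP; rewrite ?scale0r.
exists (fun i => u 0 i); split=> [//||].
  rewrite -u1 [LHS]big_mkcond; apply: eq_bigr => i _.
  by case: ifPn => // /uS.
by rewrite uz (supported_sum _ uS).
Qed.

Lemma affinely_independent_lift S u :
  affinely_independent p S -> supported S u -> u *m lift_mx = 0 -> u = 0.
Proof.
move=> indep uS; rewrite mul_lift_mx -row_mx0 => /eq_row_mx[+ /eqP].
move=> /rowP/(_ 0); rewrite !mxE eqxx mulr1n => u0.
rewrite trmx_eq0 (supported_sum _ uS) => /eqP u1.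
apply/rowP=> i; rewrite mxE; have [iS|/uS //] := boolP (i \in S).
apply: (indep (fun i => u 0 i)) iS => //; rewrite -[RHS]u0 [LHS]big_mkcond;
  apply: eq_bigr => j _.
by case: ifPn => // /uS.
Qed.

Definition select_mx (S : {set 'I_N}) : 'M[R]_(#|S|, N) :=
  rowsub (@enum_val _ (mem S)) 1%:M.

(* [q *m bary S] are the barycentric coordinates of [q] in the triangle [S]. *)
Definition bary (S : {set 'I_N}) : 'M[R]_(1 + 2, N) :=
  pinvmx (select_mx S *m lift_mx) *m select_mx S.

Lemma supported_select (S : {set 'I_N}) (v : 'rV[R]_#|S|) :
  supported S (v *m select_mx S).
Proof.
move=> i iS; rewrite mxE big1 // => k _; rewrite !mxE.
case: eqP => [ki|]; last by rewrite mulr0.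
by move: iS; rewrite -ki (enum_valP k).
Qed.

Lemma supported_bary S q : supported S (q *m bary S).
Proof. by rewrite mulmxA; apply: supported_select. Qed.

(** Affine independence makes the three selected rows of [lift_mx] free; as rows of length three
    they also have full column rank, so the pseudo-inverse is a left inverse. *)
Lemma bary_lift (S : {set 'I_N}) :
  #|S| = 3%N -> affinely_independent p S -> bary S *m lift_mx = 1%:M.
Proof.
move=> S3 indep; rewrite -mulmxA mulVpmx //.
rewrite -col_leq_rank -[leqLHS]S3.
suff /eqP -> : row_free (select_mx S *m lift_mx) by [].
rewrite -kermx_eq0; apply/eqP/row_matrixP => k; rewrite row0.
have /sub_kermxP : (row k (kermx (select_mx S *m lift_mx)) <=
  kermx (select_mx S *m lift_mx))%MS by apply: row_sub.
move: (row k _) => v v0.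
have {v0} : v *m select_mx S = 0.
  apply: affinely_independent_lift (@supported_select S v) _ => //.
  by rewrite -mulmxA.
move=> v0; apply/rowP=> j; move/rowP/(_ (enum_val j)): v0.
rewrite !mxE (bigD1 j) //= !mxE eqxx mulr1 big1 ?addr0 // => i ij.
rewrite !mxE; case: eqP => [/enum_val_inj eij|]; last by rewrite mulr0.
by rewrite eij eqxx in ij.
Qed.

Lemma bary_unique (S : {set 'I_N}) u : #|S| = 3%N -> affinely_independent p S ->
  supported S u -> u *m lift_mx *m bary S = u.
Proof.
move=> S3 indep uS; apply/eqP; rewrite -subr_eq0; apply/eqP.
apply: (affinely_independent_lift indep).
  by move=> i iS; rewrite [LHS]mxE [X in _ + X]mxE uS // supported_bary // subrr.
by rewrite mulmxBl -(mulmxA (u *m lift_mx)) bary_lift // mulmx1 subrr.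
Qed.

End Barycentric.

(** * Elementary facts on intervals, polynomials and linear forms *)

Lemma uniform_radius (R : realType) (I : finType) (P : I -> R -> Prop) :
  (forall i, exists2 e, 0 < e & forall d, `|d| <= e -> P i d) ->
  exists2 e, 0 < e & forall i d, `|d| <= e -> P i d.
Proof.
move=> Pe; suff [e e0 He] : exists2 e, 0 < e &
    forall i, i \in enum I -> forall d, `|d| <= e -> P i d.
  by exists e => // i; apply: He; rewrite mem_enum.
elim: (enum I) => [|i s [e e0 He]]; first by exists 1.
have [e' e'0 He'] := Pe i; exists (Num.min e e').
  by rewrite lt_min e0.
move=> j; rewrite inE => /orP[/eqP ->|js] d; rewrite le_min => /andP[de de'].
  exact: He'.
exact: He.
Qed.

Lemma affine_pos_near (R : realType) (a b : R) : 0 < a ->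
  exists2 e, 0 < e & forall d, `|d| <= e -> 0 < a + d * b.
Proof.
move=> a0; have b0 : 0 <= `|b| by [].
exists (a / (2 * (`|b| + 1))).
  by apply: divr_gt0 => //; lra.
move=> d; rewrite ler_pdivlMr; last by lra.
move=> h; have : `|d * b| <= a / 2.
  rewrite normrM; have d0 : 0 <= `|d| by [].
  nra.
by move=> /ler_normlP[]; lra.
Qed.

(* [A] and [B] are closed on [0, 1], stated through their complements. *)
Lemma unit_interval_connected (R : realType) (A B : R -> Prop) :
  (forall t, 0 <= t <= 1 -> A t \/ B t) ->
  (forall t, 0 <= t <= 1 -> A t -> B t -> False) ->
  (forall t, ~ A t -> exists2 e, 0 < e & forall d, `|d| <= e -> ~ A (t + d)) ->
  (forall t, ~ B t -> exists2 e, 0 < e & forall d, `|d| <= e -> ~ B (t + d)) ->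
  A 0 -> ~ B 1.
Proof.
move=> cover disj openA openB A0 B1.
pose S : classical_sets.set R := fun t => 0 <= t <= 1 /\ A t.
have S0 : S 0 by split=> //; rewrite lexx ler01.
have Sub : classical_sets.has_ubound S by exists 1 => t [/andP[]].
have Ssup : classical_sets.has_sup S by split=> //; exists 0.
set s := reals.sup S.
have s0 : 0 <= s by apply: ub_le_sup.
have s1 : s <= 1 by apply: ge_sup; [exists 0|move=> t [/andP[]]].
have s01 : 0 <= s <= 1 by rewrite s0.
(* Neither case is possible: if the supremum [s] lies in [A], then [A] continues beyond [s]; if it
   lies in [B], a whole neighbourhood of [s] misses [A]. *)
have [As|Bs] := cover _ s01.
  have [e e0 He] := openB s (disj _ s01 As).
  have s_lt1 : s < 1.
    rewrite lt_neqAle s1 andbT; apply/eqP => sE.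
    by apply: (disj s) => //; rewrite sE.
  pose d := Num.min e (1 - s).
  have d0 : 0 < d by rewrite lt_min e0 subr_gt0.
  have de : d <= e by rewrite ge_min lexx.
  have ds : d <= 1 - s by rewrite ge_min lexx orbT.
  have sd01 : 0 <= s + d <= 1 by apply/andP; split; lra.
  have nB : ~ B (s + d) by apply: He; rewrite gtr0_norm.
  have Asd : A (s + d) by case: (cover _ sd01).
  have : s + d <= s by apply: ub_le_sup.
  by lra.
have nA : ~ A s by move=> As; apply: (disj s).
have [e e0 He] := openA s nA.
have [t [t01 At] st] := sup_adherent e0 Ssup.
have ts : t <= s by apply: ub_le_sup.
apply: (He (t - s)); last by rewrite addrC subrK.
by rewrite ler0_norm; move: st; rewrite -/s; lra.
Qed.

Lemma poly_nonroot_pos (R : realType) (f : {poly R}) :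
  f != 0 -> exists2 e, 0 < e & f.[e] != 0.
Proof.
move=> f0; pose s := [seq (k.+1)%:R : R | k <- iota 0 (size f)].
have /allPn[e /mapP[k _ ->] nroot] : ~~ all (root f) s.
  apply/negP => /(max_poly_roots f0); rewrite size_map size_iota ltnn.
  suff us : uniq s by move=> /(_ us).
  by rewrite map_inj_uniq ?iota_uniq // => i j /eqP; rewrite eqr_nat eqSS => /eqP.
by exists k.+1%:R; rewrite ?ltr0Sn.
Qed.

(** Two equations in three unknowns; geometrically, [l] is a line through the points with
    homogeneous coordinates [q] and [r]. *)
Lemma annihilator2 (F : fieldType) (q r : 'rV[F]_(1 + 2)) :
  exists2 l : 'cV[F]_(1 + 2), l != 0 & q *m l = 0 /\ r *m l = 0.
Proof.
pose A := row_mx q^T r^T.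
have kerA : kermx A != 0.
  rewrite -mxrank_eq0 mxrank_ker -lt0n subn_gt0.
  exact: leq_ltn_trans (rank_leq_col A) _.
exists (nz_row (kermx A))^T; first by rewrite trmx_eq0 nz_row_eq0.
have /sub_kermxP := nz_row_sub (kermx A).
rewrite mul_mx_row -row_mx0 => /eq_row_mx[q0 r0].
by split; apply: trmx_inj; rewrite trmx_mul trmxK ?q0 ?r0 trmx0.
Qed.

(** * Connectivity of triangulations and stresses *)

Section Triangulation.

Context (R : realType) (N : nat) (p : 'M[R]_(2, N)) (T : {set {set 'I_N}}).
Context (Htri : is_triangulation p T).

Local Notation P := (lift_mx p).

Definition indic (S : {set 'I_N}) : 'rV[R]_N := \row_i (i \in S)%:R.

Lemma supported_indic S : supported S (indic S).
Proof. by move=> i iS; rewrite mxE (negbTE iS). Qed.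

Lemma supportedD S (u v : 'rV[R]_N) :
  supported S u -> supported S v -> supported S (u + v).
Proof. by move=> uS vS i iS; rewrite mxE uS // vS // addr0. Qed.

Lemma supportedZ S a (u : 'rV[R]_N) : supported S u -> supported S (a *: u).
Proof. by move=> uS i iS; rewrite mxE uS // mulr0. Qed.

Lemma supportedS (S S' : {set 'I_N}) (u : 'rV[R]_N) :
  S \subset S' -> supported S u -> supported S' u.
Proof. by move=> sub uS i iS; apply: uS; apply: contraNN iS => /(subsetP sub). Qed.

Lemma tri_bary_lift t : t \in T -> bary p t *m P = 1%:M.
Proof.
by move=> tT; apply: bary_lift;
  [exact: (tri_card Htri)|exact: (tri_nondegenerate Htri)].
Qed.

Lemma tri_bary_unique t u : t \in T -> supported t u -> u *m P *m bary p t = u.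
Proof.
by move=> tT; apply: bary_unique;
  [exact: (tri_card Htri)|exact: (tri_nondegenerate Htri)].
Qed.

Lemma sum_supported_gt0 (s : {set 'I_N}) (u : 'rV[R]_N) :
  s != finset.set0 -> supported s u -> (forall i, i \in s -> 0 < u 0 i) ->
  0 < \sum_i u 0 i.
Proof.
move=> /set0Pn[i0 i0s] us u0.
have u_ge0 i : 0 <= u 0 i.
  by have [/u0/ltW //|/us ->] := boolP (i \in s).
by rewrite (bigD1 i0) //= ltr_pwDl ?u0 // sumr_ge0.
Qed.

Lemma tri_neq0 s : s \in T -> s != finset.set0.
Proof. by move=> /(tri_card Htri) s3; rewrite -card_gt0 s3. Qed.

(** The homogeneous form of [tri_no_overlap]: dividing by the weight sum, which [lift_mx] records
    and which is therefore common to [u] and [v], reduces to actual points. *)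
Lemma relint_cones_disjoint s t u v : s \in T -> t \in T ->
  supported s u -> supported t v ->
  (forall i, i \in s -> 0 < u 0 i) -> (forall i, i \in t -> 0 < v 0 i) ->
  u *m P = v *m P -> s = t.
Proof.
move=> sT tT us vt u0 v0 uv; apply/eqP; apply: contraT => st; exfalso.
have c0 := sum_supported_gt0 (tri_neq0 sT) us u0.
set c := \sum_i u 0 i in c0.
pose z := \sum_i (c^-1 *: u) 0 i *: col i p.
have uz : (c^-1 *: u) *m P = lift_pt z.
  apply/mul_lift_mx_pt; split=> //.
  rewrite -(mulVf (lt0r_neq0 c0)) mulr_sumr.
  by apply: eq_bigr => i _; rewrite mxE.
apply: (@tri_no_overlap _ _ _ _ Htri s t sT tT st z); apply/in_relintP.
  exists (c^-1 *: u); split=> //; first exact: supportedZ.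
  by move=> i /u0 ui; rewrite mxE mulr_gt0 ?invr_gt0.
exists (c^-1 *: v); split; first exact: supportedZ.
  by move=> i /v0 ui; rewrite mxE mulr_gt0 ?invr_gt0.
by rewrite -scalemxAl -uv scalemxAl.
Qed.

Lemma pos_near (S : {set 'I_N}) (u v : 'rV[R]_N) :
  (forall i, i \in S -> 0 < u 0 i) ->
  exists2 e, 0 < e & forall i, i \in S -> 0 < (u + e *: v) 0 i.
Proof.
move=> u0.
have [|e e0 He] := @uniform_radius R 'I_N
    (fun i d => i \in S -> 0 < u 0 i + d * v 0 i).
  move=> i; have [iS|iS] := boolP (i \in S); last by exists 1.
  by have [e e0 He] := affine_pos_near (v 0 i) (u0 i iS); exists e => // d /He.
exists e => // i iS; rewrite !mxE; apply: He => //.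
by rewrite gtr0_norm.
Qed.

(** Moving [u] slightly in the direction [indic s] makes it positive on [s]; moving [v] by the
    barycentric coordinates in [t] of that direction keeps the images equal and, for a small step,
    keeps [v] positive on [t]. *)
Lemma hull_relint_cones s t u v : s \in T -> t \in T ->
  supported s u -> supported t v ->
  (forall i, 0 <= u 0 i) -> (forall i, i \in t -> 0 < v 0 i) ->
  u *m P = v *m P -> s = t.
Proof.
move=> sT tT us vt u0 v0 uv.
pose b := indic s *m P *m bary p t.
have [e e0 He] := pos_near b v0.
apply: (@relint_cones_disjoint s t (u + e *: indic s) (v + e *: b)) => //.
- by apply: supportedD => //; apply: supportedZ; apply: supported_indic.
- by apply: supportedD => //; apply: supportedZ; apply: supported_bary.
- by move=> i i_s; rewrite !mxE i_s mulr1; apply: ltr_wpDl.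
- by rewrite !mulmxDl -!scalemxAl /b -[in RHS]mulmxA tri_bary_lift // mulmx1 uv.
Qed.

(** By [hull_relint_cones], a triangle with vertex [i] would coincide with [t]; uniqueness of
    barycentric coordinates would then put all weight at [i], against positivity at the other
    vertices. *)
Lemma vertex_notin_relint i t v : t \in T -> supported t v ->
  (forall j, j \in t -> 0 < v 0 j) -> row i P != v *m P.
Proof.
move=> tT vt v0; apply/eqP; rewrite rowE => iv.
have [s sT i_s] := tri_vertex Htri i.
have ds : supported s (delta_mx 0 i : 'rV[R]_N).
  by move=> j; rewrite mxE eqxx /=; case: eqP => // ->; rewrite i_s.
have st : s = t.
  apply: (hull_relint_cones sT tT ds vt _ v0 iv) => j.
  by rewrite mxE ler0n.
have vi : v = delta_mx 0 i.
  by rewrite -(tri_bary_unique tT vt) -iv tri_bary_unique // -st.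
have /set0Pn[j] : t :\ i != finset.set0.
  by rewrite -card_gt0 -(ltn_add2l (i \in t)) -cardsD1 (tri_card Htri tT);
    case: (i \in t).
rewrite in_setD1 => /andP[ji /v0]; rewrite vi mxE (negbTE ji) andbF ltxx //.
Qed.

(** Some coordinate vanishes, at [i0]. A second vanishing one would leave all weight at a single
    label and make [z] a vertex, so [z] lies in the open edge opposite [i0]. *)
Lemma edge_of_boundary s u z : s \in T -> supported s u ->
  (forall i, 0 <= u 0 i) -> u *m P = lift_pt z ->
  (forall i, lift_pt z != row i P) -> ~~ [forall (i | i \in s), 0 < u 0 i] ->
  exists2 e : {set 'I_N}, e \subset s & #|e| = 2%N /\ in_relint p e z.
Proof.
move=> sT us u0 uz nv /forall_inPn[i0 i0s];
  rewrite lt_neqAle u0 andbT negbK eq_sym => /eqP ui0.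
have c2 : #|s :\ i0| = 2%N.
  by move: (cardsD1 i0 s); rewrite i0s (tri_card Htri sT) => -[].
exists (s :\ i0); first exact: subD1set.
split=> //; apply/in_relintP; exists u; split=> //.
  move=> i; rewrite in_setD1 negb_and negbK => /orP[/eqP -> //|/us //].
move=> i; rewrite in_setD1 => /andP[ii0 i_s]; rewrite lt_neqAle u0 andbT.
apply/negP => /eqP/esym ui.
have /cards1P[k sk] : #|s :\ i0 :\ i| == 1%N.
  by move: (cardsD1 i (s :\ i0)); rewrite in_setD1 ii0 i_s c2 => -[/esym/eqP].
have uj j : j != k -> u 0 j = 0.
  move=> jk; have [j_s|/us //] := boolP (j \in s).
  have := in_set1 j k; rewrite -sk (negbTE jk) !in_setD1 j_s andbT.
  by case: eqP => [->|_] //=; case: eqP => [->|].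
have [u1 _] := (mul_lift_mx_pt p u z).1 uz.
move: u1; rewrite (bigD1 k) //= big1 ?addr0 => [uk1|j]; last exact: uj.
have uk : u = delta_mx 0 k.
  apply/rowP=> j; rewrite mxE eqxx /=; have [->|/uj] := eqVneq j k;
    first exact: uk1.
  by [].
by have /eqP[] := nv k; rewrite -uz uk rowE.
Qed.

(** The common point is interior to neither triangle, hence lies in an open edge of each; since
    edges do not cross, the two edges coincide. *)
Lemma meet_adjacent s t u v z : s \in T -> t \in T -> s != t ->
  supported s u -> supported t v ->
  (forall i, 0 <= u 0 i) -> (forall i, 0 <= v 0 i) ->
  u *m P = lift_pt z -> v *m P = lift_pt z ->
  (forall i, lift_pt z != row i P) -> tri_adjacent s t.
Proof.
move=> sT tT st us vt u0 v0 uz vz nv.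
have nu : ~~ [forall (i | i \in s), 0 < u 0 i].
  apply: contraNN st => /forall_inP ugt.
  by rewrite eq_sym; apply/eqP; apply: (hull_relint_cones tT sT vt us) => //;
    rewrite uz.
have nv' : ~~ [forall (i | i \in t), 0 < v 0 i].
  apply: contraNN st => /forall_inP vgt.
  by apply/eqP; apply: (hull_relint_cones sT tT us vt) => //; rewrite uz.
have [e es [e2 ez]] := edge_of_boundary sT us u0 uz nv nu.
have [f ft [f2 fz]] := edge_of_boundary tT vt v0 vz nv nv'.
have ef : e = f.
  move/eqP/cards2P: (e2) => [i [j [ij eij]]].
  move/eqP/cards2P: (f2) => [k [l [kl fkl]]].
  apply/eqP; apply: contraT => nef; exfalso.
  apply: (@tri_no_crossing _ _ _ _ Htri i j k l _ _ _ z).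
  - rewrite /tri_edge ij; apply/exists_inP; exists s => //.
    by rewrite !(subsetP es) // eij !inE eqxx ?orbT.
  - rewrite /tri_edge kl; apply/exists_inP; exists t => //.
    by rewrite !(subsetP ft) // fkl !inE eqxx ?orbT.
  - by rewrite -eij -fkl.
  - by rewrite -eij.
  - by rewrite -fkl.
have est : e \subset s :&: t by rewrite subsetI es ef ft.
rewrite /tri_adjacent eqn_leq -{2}e2 (subset_leq_card est) andbT leqNgt.
apply: contraNN st => st3; apply/eqP.
have /eqP sts : s :&: t == s.
  by rewrite eqEcard subsetIl (tri_card Htri sT).
have /eqP stt : s :&: t == t.
  by rewrite eqEcard subsetIr (tri_card Htri tT).
by rewrite -sts.
Qed.

Definition inside (t : {set 'I_N}) (q : 'rV[R]_(1 + 2)) : bool :=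
  [forall (i | i \in t), 0 <= (q *m bary p t) 0 i].

Lemma inside_hull t u : t \in T -> supported t u -> (forall i, 0 <= u 0 i) ->
  inside t (u *m P).
Proof. by move=> tT ut u0; apply/forall_inP => i it; rewrite tri_bary_unique. Qed.

Lemma inside_ge0 t q : inside t q -> forall i, 0 <= (q *m bary p t) 0 i.
Proof.
move=> /forall_inP q0 i; have [/q0 //|it] := boolP (i \in t).
by rewrite supported_bary.
Qed.

Lemma outside_near t q r : ~~ inside t q ->
  exists2 e, 0 < e & forall d, `|d| <= e -> ~~ inside t (q + d *: r).
Proof.
move=> /forall_inPn[i it]; rewrite -ltNge => qi.
have [|e e0 He] := @affine_pos_near R (- (q *m bary p t) 0 i) (- (r *m bary p
  t) 0 i).
  by rewrite oppr_gt0.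
exists e => // d /He rd; apply/forall_inPn; exists i => //.
rewrite -ltNge mulmxDl -scalemxAl [ltLHS]mxE [X in _ + X < 0]mxE.
by rewrite -oppr_gt0 opprD -mulrN.
Qed.

(** The weights are powers [e ^+ j], normalized at the end. Pairing them with [l i] gives a
    polynomial in [e], nonzero because its coefficients are the values of [l i] at the vertices of
    [t], which span; one positive [e] avoids the roots for all [i]. *)
Lemma general_position t (l : 'I_N -> 'cV[R]_(1 + 2)) : t \in T ->
  (forall i, l i != 0) ->
  exists u, [/\ supported t u, forall i, i \in t -> 0 < u 0 i,
    \sum_i u 0 i = 1 & forall i, u *m P *m l i != 0].
Proof.
move=> tT l0.
pose f i : {poly R} := \sum_(j in t) (P *m l i) j 0 *: 'X^j.
have f0 i : f i != 0.
  apply: contra (l0 i) => /eqP fi0; rewrite -[l i]mul1mx -(tri_bary_lift tT).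
  rewrite -mulmxA; apply/eqP/matrixP => r c; rewrite !mxE big1 // => j _.
  have [jt|jt] := boolP (j \in t); last first.
    have := supported_bary p (row r 1%:M) jt.
    by rewrite -row_mul mul1mx mxE => ->; rewrite mul0r.
  move/(congr1 (fun g : {poly R} => g`_j)): fi0.
  rewrite coef0 coef_sum (bigD1 j) //= coefZ coefXn eqxx mulr1 big1 ?addr0.
    by rewrite ord1 => ->; rewrite mulr0.
  move=> k /andP[_ kj]; rewrite coefZ coefXn.
  have /negbTE -> : (j : nat) != k by rewrite eq_sym.
  by rewrite mulr0.
have /poly_nonroot_pos[e e0] : \prod_i f i != 0 by apply/prodf_neq0 => i _.
rewrite horner_prod => /prodf_neq0 fe.
pose w : 'rV[R]_N := \row_j (if j \in t then e ^+ j else 0).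
have wt : supported t w by move=> j jt; rewrite mxE (negbTE jt).
have w0 j : j \in t -> 0 < w 0 j by move=> jt; rewrite mxE jt exprn_gt0.
have c0 := sum_supported_gt0 (tri_neq0 tT) wt w0.
set c := \sum_i w 0 i in c0.
exists (c^-1 *: w); split.
- exact: supportedZ.
- by move=> j /w0 wj; rewrite mxE mulr_gt0 ?invr_gt0.
- rewrite -(mulVf (lt0r_neq0 c0)) mulr_sumr.
  by apply: eq_bigr => i _; rewrite mxE.
- move=> i; rewrite -!scalemxAl scaler_eq0 invr_eq0 (gt_eqF c0) /=.
  apply: contra (fe i isT) => /eqP/matrixP/(_ 0 0).
  rewrite -mulmxA mxE [in RHS]mxE => <-.
  rewrite horner_sum [in X in X == _]big_mkcond /=; apply/eqP/eq_bigr => j _.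
  rewrite [w _ _]mxE; case: ifP => _; rewrite ?mul0r //.
  by rewrite hornerZ hornerXn mulrC.
Qed.

(* The segment from the centroid of a triangle in [C] to a general point of a
   triangle outside [C] avoids all vertices.  The triangles in [C] and those
   outside cover it by two closed sets, so they meet in a point that is not a
   vertex, and there two triangles share an edge. *)
Lemma triangulation_connected (C : {set 'I_N} -> bool) :
  (forall s t, s \in T -> t \in T -> tri_adjacent s t -> C s -> C t) ->
  (exists2 s, s \in T & C s) -> forall t, t \in T -> C t.
Proof.
move=> Cadj [s0 s0T Cs0] t1 t1T; apply: contraT => nCt1; exfalso.
pose u1 : 'rV[R]_N := 3%:R^-1 *: indic s0.
have u1s : supported s0 u1 by apply: supportedZ; apply: supported_indic.
have u1_gt0 i : i \in s0 -> 0 < u1 0 i.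
  by move=> i_s; rewrite !mxE i_s mulr1 invr_gt0 ltr0n.
have u1_ge0 i : 0 <= u1 0 i by rewrite !mxE mulr_ge0 ?invr_ge0 ?ler0n.
have u1_sum : \sum_i u1 0 i = 1.
  transitivity (\sum_(i in s0) 3%:R^-1 : R).
    rewrite [RHS]big_mkcond; apply: eq_bigr => i _; rewrite !mxE.
    by case: ifP; rewrite ?mulr1 ?mulr0.
  by rewrite sumr_const (tri_card Htri s0T) -[_ *+ 3]mulr_natr mulVf ?pnatr_eq0.
clearbody u1.
(* [l i] is a line through the centroid and the vertex [i]. The end point [u2] is chosen off all of
   these lines. *)
have /fin_all_exists[l Hl] : forall i, exists l : 'cV[R]_(1 + 2),
    [/\ l != 0, u1 *m P *m l = 0 & row i P *m l = 0].
  by move=> i; have [l ? []] := annihilator2 (u1 *m P) (row i P); exists l.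
have [|u2 [u2t u2_gt0 u2_sum u2l]] := @general_position t1 l t1T.
  by move=> i; case: (Hl i).
have u2_ge0 i : 0 <= u2 0 i.
  by have [/u2_gt0/ltW //|/u2t ->] := boolP (i \in t1).
pose q d := u1 *m P + d *: (u2 *m P - u1 *m P).
have q0 : q 0 = u1 *m P by rewrite /q scale0r addr0.
have q1 : q 1 = u2 *m P by rewrite /q scale1r addrC subrK.
have qD d e : q (d + e) = q d + e *: (u2 *m P - u1 *m P).
  by rewrite /q scalerDl addrA.
pose u d := u1 + d *: (u2 - u1).
have qu d : q d = u d *m P by rewrite mulmxDl -scalemxAl mulmxBl.
pose z d := \sum_i u d 0 i *: col i p.
have qz d : q d = lift_pt (z d).
  rewrite qu; apply/mul_lift_mx_pt; split=> //.
  transitivity (\sum_i (u1 0 i + d * (u2 0 i - u1 0 i))).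
    by apply: eq_bigr => i _; rewrite !mxE.
  by rewrite big_split /= -mulr_sumr sumrB u2_sum u1_sum subrr mulr0 addr0.
have u_ge0 d : 0 <= d <= 1 -> forall i, 0 <= u d 0 i.
  move=> /andP[d0 d1] i; rewrite !mxE.
  have := u1_ge0 i; have := u2_ge0 i; nra.
(* The form [l i] vanishes at the vertex, while at [q d] it is [d] times its nonzero value at [u2];
   only [d = 0] remains, the centroid, which is no vertex. *)
have q_notvertex d i : q d != row i P.
  apply/eqP => qi; have [_ l1 li] := Hl i.
  have /negbTE u2l' : (u2 *m P - u1 *m P) *m l i != 0.
    by rewrite mulmxBl l1 subr0.
  have d0 : d != 0.
    apply/eqP => d0; move: qi; rewrite d0 q0 => /esym/eqP.
    by rewrite (negbTE (vertex_notin_relint i s0T u1s u1_gt0)).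
  move/(congr1 (mulmx^~ (l i))): qi.
  rewrite li /q mulmxDl l1 add0r -scalemxAl => /eqP.
  by rewrite scaler_eq0 (negbTE d0) u2l'.
pose A d := exists2 t, t \in T & C t && inside t (q d).
pose B d := exists2 t, t \in T & ~~ C t && inside t (q d).
have near_open (D : {set 'I_N} -> bool) d :
    ~ (exists2 t, t \in T & D t && inside t (q d)) ->
    exists2 e, 0 < e & forall c, `|c| <= e ->
      ~ (exists2 t, t \in T & D t && inside t (q (d + c))).
  move=> nD; have [|e e0 He] := @uniform_radius R _
    (fun t c => t \in T -> D t -> ~~ inside t (q (d + c))).
    move=> t; have [/andP[tT Dt]|] := boolP ((t \in T) && D t); last first.
      by move=> ntD; exists 1 => // c _ tT Dt; rewrite tT Dt in ntD.
    have [|e e0 He] := @outside_near t (q d) (u2 *m P - u1 *m P).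
      by apply/negP => itd; apply: nD; exists t; rewrite ?Dt.
    by exists e => // c /He; rewrite -qD.
  exists e => // c ce [t tT /andP[Dt]]; apply/negP; exact: (He t c ce).
apply: (@unit_interval_connected R A B).
- move=> d d01; have : in_hull p [set: 'I_N] (z d).
    by apply/in_hullP; exists (u d); split; rewrite -?qu //; [move=> i;
      rewrite inE|apply: u_ge0].
  move=> /(tri_cover Htri)[t tT /in_hullP[v [vt v0 vz]]].
  have : inside t (q d) by rewrite qz -vz; apply: inside_hull.
  by have [Ct|nCt] := boolP (C t); [left|right]; exists t; rewrite ?Ct ?nCt.
(* A parameter in both [A] and [B] gives a point, not a vertex, common to two triangles; these are
   adjacent by [meet_adjacent], so [C] would propagate. *)
- move=> d _ [s sT /andP[Cs si]] [t tT /andP[nCt ti]].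
  suff : tri_adjacent s t by move=> /(Cadj s t sT tT)/(_ Cs); rewrite (negbTE nCt).
  apply: (@meet_adjacent s t (q d *m bary p s) (q d *m bary p t) (z d)) => //.
  + by apply: contraNneq nCt => <-.
  + exact: supported_bary.
  + exact: supported_bary.
  + exact: inside_ge0.
  + exact: inside_ge0.
  + by rewrite -mulmxA tri_bary_lift // mulmx1 qz.
  + by rewrite -mulmxA tri_bary_lift // mulmx1 qz.
  + by move=> i; rewrite -qz.
- by move=> d; apply: near_open.
- by move=> d; apply: near_open.
- by exists s0 => //; rewrite Cs0 q0 inside_hull.
- by exists t1 => //; rewrite nCt1 q1 inside_hull.
Qed.

(* The affine dependence that writes the apex of [t] in the barycentric
   coordinates of the adjacent triangle [s]. *)
Definition stress (s t : {set 'I_N}) : 'rV[R]_N :=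
  indic (t :\: s) - indic (t :\: s) *m P *m bary p s.

Lemma stress_lift s t : s \in T -> stress s t *m P = 0.
Proof. by move=> sT;
  rewrite mulmxBl -[X in _ - X]mulmxA tri_bary_lift // mulmx1 subrr. Qed.

Lemma supported_stress s t : supported (s :|: t) (stress s t).
Proof.
move=> i; rewrite in_setU negb_or => /andP[i_s it].
by rewrite mxE [X in _ + X]mxE supported_bary // mxE in_setD (negbTE it) andbF
  subr0.
Qed.

Lemma adjacent_apex s t : t \in T -> tri_adjacent s t ->
  exists l, t :\: s = [set l].
Proof.
move=> tT /eqP st2; apply/cards1P.
by rewrite cardsD setIC st2 (tri_card Htri tT).
Qed.

Lemma adjacent_sym (s t : {set 'I_N}) : tri_adjacent s t = tri_adjacent t s.
Proof. by rewrite /tri_adjacent setIC. Qed.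

Lemma adjacent_neq s t : s \in T -> tri_adjacent s t -> s != t.
Proof.
by move=> sT /eqP st2; apply/eqP => st; move: st2;
  rewrite -st setIid (tri_card Htri sT).
Qed.

Lemma stress_far s t l : l \in t :\: s -> stress s t 0 l = 1.
Proof.
move=> lts; rewrite mxE [X in _ + X]mxE supported_bary; last first.
  by move: lts; rewrite in_setD => /andP[].
by rewrite mxE lts subr0.
Qed.

(** The entry is minus the barycentric coordinate [g 0 i] in [s] of the apex of [t]. Were that
    coordinate zero, [t] would be degenerate; were it positive, both apexes would lie on the same
    side of the common edge and the triangles would overlap. *)
Lemma stress_near s t i : s \in T -> t \in T -> tri_adjacent s t ->
  i \in s :\: t -> 0 < stress s t 0 i.
Proof.
move=> sT tT st; rewrite in_setD => /andP[it i_s].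
have [l tl] := adjacent_apex tT st.
have lt : l \in t :\: s by rewrite tl set11.
have [k sk] : exists k, s :\: t = [set k] by apply: adjacent_apex;
  rewrite // adjacent_sym.
have siE j : j \in s -> (j != i) -> j \in t.
  move=> js ji; apply: contraNT ji => jt.
  have : j \in s :\: t by rewrite in_setD jt.
  have : i \in s :\: t by rewrite in_setD it.
  by rewrite sk !inE => /eqP -> /eqP ->.
set g := indic (t :\: s) *m P *m bary p s.
have gs : supported s g by apply: supported_bary.
have gP : g *m P = indic (t :\: s) *m P
  by rewrite -[LHS]mulmxA tri_bary_lift ?mulmx1.
have si : stress s t 0 i = - g 0 i.
  by rewrite mxE [X in _ + X]mxE mxE in_setD (negbTE it) andbF add0r.
rewrite si oppr_gt0 ltNge le_eqVlt; apply/negP => /orP[/eqP gi|gi].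
  have ut : supported t (stress s t).
    move=> j jt; have [js|js] := boolP (j \in s).
      have -> : j = i by apply/eqP; apply: contraNT jt; apply: siE.
      by rewrite si -gi oppr0.
    by apply: supported_stress; rewrite in_setU negb_or js.
  have u0 := affinely_independent_lift (tri_nondegenerate Htri tT) ut
    (stress_lift t sT).
  by move: (stress_far lt); rewrite u0 mxE => /eqP; rewrite eq_sym oner_eq0.
(* From the common edge, a small step towards the apex of [t] enters the interiors of both
   triangles. *)
have [|e e0 He] := @pos_near (s :&: t) (indic (s :&: t)) g.
  by move=> j jst; rewrite mxE jst ltr01.
have /negP[] := adjacent_neq sT st; apply/eqP.
apply: (@relint_cones_disjoint s t (indic (s :&: t) + e *: g)
  (indic (s :&: t) + e *: indic (t :\: s))) => //.
- apply: supportedD; last by apply: supportedZ.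
  exact: supportedS (subsetIl _ _) (@supported_indic _).
- apply: supportedD; last apply: supportedZ.
    exact: supportedS (subsetIr _ _) (@supported_indic _).
  exact: supportedS (subsetDl _ _) (@supported_indic _).
- move=> j js; have [->|ji] := eqVneq j i; last first.
    by apply: He; rewrite in_setI js siE.
  by rewrite mxE mxE in_setI (negbTE it) andbF add0r mxE mulr_gt0.
- move=> j jt; rewrite !mxE in_setI in_setD jt andbT.
  by case: (j \in s); rewrite /= ?mulr0 ?mulr1 ?addr0 ?add0r.
- by rewrite !mulmxDl -!scalemxAl gP.
Qed.

Lemma bary_eq_in (t : {set 'I_N}) (v w : 'cV[R]_N) :
  (forall j, j \in t -> v j 0 = w j 0) -> bary p t *m v = bary p t *m w.
Proof.
move=> vw; apply/matrixP => r c; rewrite !mxE; apply: eq_bigr => j _.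
rewrite ord1; have [/vw -> //|jt] := boolP (j \in t).
have := supported_bary p (row r 1%:M) jt.
by rewrite -row_mul mul1mx mxE => ->; rewrite !mul0r.
Qed.

Lemma bary_vertex t (v : 'cV[R]_N) j : t \in T -> j \in t ->
  (P *m (bary p t *m v)) j 0 = v j 0.
Proof.
move=> tT jt; have dt : supported t (delta_mx 0 j : 'rV[R]_N).
  by move=> i; rewrite mxE eqxx /=; case: eqP => // ->; rewrite jt.
transitivity ((row j (P *m (bary p t *m v))) 0 0); first by rewrite [RHS]mxE.
by rewrite rowE (mulmxA _ P) (mulmxA _ (bary p t)) tri_bary_unique // -rowE mxE.
Qed.

(* A vector orthogonal to all stresses is affine on each triangle, and adjacent
   triangles carry the same affine function. *)
Lemma stress_kernel (v : 'cV[R]_N) :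
  (forall s t, s \in T -> t \in T -> tri_adjacent s t -> stress s t *m v = 0) ->
  exists c : 'cV[R]_(1 + 2), v = P *m c.
Proof.
move=> v0; have [T0|[s0 s0T]] := set_0Vmem T.
  exists 0; apply/colP => i; have [t] := tri_vertex Htri i.
  by rewrite T0 inE.
exists (bary p s0 *m v).
have bary_s0 t : t \in T -> bary p t *m v == bary p s0 *m v.
  apply: (@triangulation_connected (fun t => bary p t *m v == bary p s0 *m v)).
    move=> s {}t sT tT st /eqP <-; apply/eqP.
    set w := bary p s *m v; rewrite -[w]mul1mx -(tri_bary_lift tT) -mulmxA.
    (* It suffices to evaluate the affine function of [s] at the vertices of [t]: on the common edge
       it interpolates [v], and at the apex [j] the vanishing stress says the same. *)
    apply: bary_eq_in => j jt; have [js|js] := boolP (j \in s).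
      by rewrite bary_vertex.
    have [l tl] := adjacent_apex tT st.
    have lj : l = j by have : j \in t :\: s;
      [rewrite in_setD js|rewrite tl inE => /eqP].
    have /eqP := v0 s t sT tT st; rewrite /stress.
    have -> : indic (t :\: s) = delta_mx 0 j.
      by apply/rowP => i; rewrite tl lj !mxE inE.
    rewrite mulmxBl subr_eq0 -(mulmxA _ (bary p s)) -(mulmxA _ P) -!rowE.
    by move=> /eqP/matrixP/(_ 0 0); rewrite mxE [RHS]mxE.
  by exists s0.
apply/colP => i; have [t tT it] := tri_vertex Htri i.
by rewrite -(bary_vertex v tT it) (eqP (bary_s0 t tT)).
Qed.

(** * The stress matrix and its entries at non-edges *)

Definition adjacent_pair (st : {set 'I_N} * {set 'I_N}) : bool :=
  [&& st.1 \in T, st.2 \in T & tri_adjacent st.1 st.2].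

(** An entry of the unweighted sum of rank-one stresses. A non-edge is the apex pair of more than
    one ordered pair of triangles, as [(s, t)] and [(t, s)] both count. *)
Definition raw_stress (i l : 'I_N) : R :=
  \sum_(st | adjacent_pair st) stress st.1 st.2 0 i * stress st.1 st.2 0 l.

(* Both differences are singletons, so the double sum has a single term. *)
Definition weight (st : {set 'I_N} * {set 'I_N}) : R :=
  \sum_(i in st.1 :\: st.2) \sum_(l in st.2 :\: st.1)
    (if virtual_edge T i l then (raw_stress i l)^-1 else 1).

Definition stress_mx : 'M[R]_N :=
  \sum_(st | adjacent_pair st)
    weight st *: ((stress st.1 st.2)^T *m stress st.1 st.2).

Lemma raw_stressC i l : raw_stress i l = raw_stress l i.
Proof. by apply: eq_bigr => st _; rewrite mulrC. Qed.

Lemma tri_edgeC i l : tri_edge T i l = tri_edge T l i.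
Proof.
rewrite /tri_edge eq_sym; congr (_ && _); apply: eq_existsb => t.
by rewrite [(i \in t) && _]andbC.
Qed.

Lemma virtual_edgeC i l : virtual_edge T i l = virtual_edge T l i.
Proof.
rewrite /virtual_edge eq_sym tri_edgeC; do 2!congr (_ && _).
apply/exists_inP/exists_inP => -[s sT /exists_inP[t tT /and3P[st i_s lt]]];
  exists t => //; apply/exists_inP; exists s => //; apply/and3P;
  by rewrite adjacent_sym.
Qed.

Lemma tri_edge_in i l t : i != l -> t \in T -> i \in t -> l \in t -> tri_edge T i l.
Proof. by move=> il tT it lt; rewrite /tri_edge il; apply/exists_inP; exists t;
  rewrite ?it. Qed.

(** A stress lives on the four vertices of the two triangles, and any two of these except the apex
    pair share a triangle. *)
Lemma nonedge_apex i l st : i != l -> ~~ tri_edge T i l -> adjacent_pair st ->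
  stress st.1 st.2 0 i * stress st.1 st.2 0 l != 0 ->
  i \in st.1 :\: st.2 /\ l \in st.2 :\: st.1 \/
  l \in st.1 :\: st.2 /\ i \in st.2 :\: st.1.
Proof.
case: st => s t /= il nil /and3P[/= sT tT st].
rewrite mulf_eq0 negb_or => /andP[si sl].
have iU : i \in s :|: t.
  by apply: contraNT si => iU; rewrite supported_stress.
have lU : l \in s :|: t.
  by apply: contraNT sl => lU; rewrite supported_stress.
have nS r : r \in T -> ~~ ((i \in r) && (l \in r)).
  move=> rT; apply: contraNN nil => /andP[ir lr]; exact: tri_edge_in ir lr.
have := nS s sT; have := nS t tT; move: iU lU; rewrite !inE.
by case: (i \in s); case: (i \in t); case: (l \in s); case: (l \in t) => //= *; 
  [left|right].
Qed.

Lemma virtual_term i l st : virtual_edge T i l -> adjacent_pair st ->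
  0 <= stress st.1 st.2 0 i * stress st.1 st.2 0 l.
Proof.
move=> /and3P[il nil _] adj;
  have [->//|nz] := eqVneq (stress st.1 st.2 0 i * stress st.1 st.2 0 l) 0.
case: st adj nz => s t /= adj nz; case/and3P: (adj) => /= sT tT st.
by case: (nonedge_apex il nil adj nz) => /= -[a b];
  rewrite (stress_far b) ?mulr1 ?mul1r; apply/ltW/stress_near.
Qed.

Lemma raw_stress_gt0 i l : virtual_edge T i l -> 0 < raw_stress i l.
Proof.
move=> vil; have /and3P[il nil /exists_inP[s sT /exists_inP[t tT /and3P[st i_s
  lt]]]] := vil.
have adj : adjacent_pair (s, t) by rewrite /adjacent_pair /= sT tT.
have it : i \notin t by apply: contraNN nil => it; apply: tri_edge_in it lt.
have ls : l \notin s by apply: contraNN nil => ls; apply: tri_edge_in i_s ls.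
rewrite /raw_stress (bigD1 (s, t)) //=; apply: ltr_pwDl.
  rewrite (stress_far (l := l)) ?mulr1 ?in_setD ?ls //.
  by apply: stress_near; rewrite ?in_setD ?it.
by apply: sumr_ge0 => st' /andP[adj' _]; apply: virtual_term.
Qed.

Lemma weightE s t i l : adjacent_pair (s, t) ->
  i \in s :\: t -> l \in t :\: s ->
  weight (s, t) = if virtual_edge T i l then (raw_stress i l)^-1 else 1.
Proof.
move=> /and3P[/= sT tT st] i_s lt.
have [l' tl] := adjacent_apex tT st.
have [i' si] : exists k, s :\: t = [set k].
  by apply: adjacent_apex => //; rewrite adjacent_sym.
rewrite /weight /= si tl !big_set1; move: i_s lt; rewrite si tl !inE.
by move=> /eqP -> /eqP ->.
Qed.

Lemma weight_gt0 st : adjacent_pair st -> 0 < weight st.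
Proof.
case: st => s t adj; have /and3P[/= sT tT st] := adj.
have [l tl] := adjacent_apex tT st.
have [i si] : exists k, s :\: t = [set k].
  by apply: adjacent_apex => //; rewrite adjacent_sym.
rewrite (@weightE s t i l) ?si ?tl ?set11 //.
by case: ifP => // /raw_stress_gt0; rewrite invr_gt0.
Qed.

Lemma stress_mxE i l : stress_mx i l =
  \sum_(st | adjacent_pair st)
    weight st * (stress st.1 st.2 0 i * stress st.1 st.2 0 l).
Proof.
rewrite summxE; apply: eq_bigr => st _; rewrite mxE; congr (_ * _).
by rewrite mxE big_ord1 mxE.
Qed.

(** The nonzero terms of one virtual entry all have [i] and [l] as apexes, hence the same weight,
    the inverse of their unweighted total. *)
Lemma stress_mx_virtual i l : virtual_edge T i l -> stress_mx i l = 1.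
Proof.
move=> vil; rewrite stress_mxE -(mulVf (lt0r_neq0 (raw_stress_gt0 vil))) mulr_sumr.
apply: eq_bigr => -[s t] adj; have /and3P[il nil _] := vil.
have [->|nz] := eqVneq (stress s t 0 i * stress s t 0 l) 0; first by rewrite !mulr0.
congr (_ * _); case: (nonedge_apex il nil adj nz) => /= -[a b].
  by rewrite (weightE adj a b) vil.
by rewrite (weightE adj a b) virtual_edgeC vil raw_stressC.
Qed.

Lemma stress_mx_nonedge i l : i != l -> ~~ tri_edge T i l ->
  ~~ virtual_edge T i l -> stress_mx i l = 0.
Proof.
move=> il nil nvil; rewrite stress_mxE big1 // => -[s t] adj.
have [->|nz] := eqVneq (stress s t 0 i * stress s t 0 l) 0; first by rewrite mulr0.
have /and3P[/= sT tT st] := adj.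
case/negP: nvil; rewrite /virtual_edge il nil.
case: (nonedge_apex il nil adj nz) => /= -[]; rewrite !in_setD.
  move=> /andP[_ i_s] /andP[_ lt]; apply/exists_inP; exists s => //.
  by apply/exists_inP; exists t => //; apply/and3P.
move=> /andP[_ ls] /andP[_ it]; apply/exists_inP; exists t => //.
by apply/exists_inP; exists s => //; apply/and3P; rewrite adjacent_sym.
Qed.

Lemma stress_mx_sym : stress_mx^T = stress_mx.
Proof.
rewrite /stress_mx linear_sum; apply: eq_bigr => st _ /=.
by rewrite linearZ /= trmx_mul trmxK.
Qed.

Lemma stress_mx_lift : stress_mx *m P = 0.
Proof.
rewrite mulmx_suml big1 // => -[s t] /and3P[/= sT _ _].
by rewrite -scalemxAl -mulmxA stress_lift // mulmx0 scaler0.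
Qed.

End Triangulation.

(** * Generic points in the plane *)

Lemma generic_noncollinear (R : realType) (N : nat) (p : 'M[R]_(2, N))
    (i j k : 'I_N) :
  generic p -> j != i -> k != i -> j != k ->
  (p 0 j - p 0 i) * (p 1 k - p 1 i) - (p 0 k - p 0 i) * (p 1 j - p 1 i) != 0.
Proof.
move=> gen ji ki jk.
pose X r c : {mpoly rat[2 * N]} := 'X_(mxvec_index r c).
pose q := (X 0 j - X 0 i) * (X 1 k - X 1 i) - (X 0 k - X 0 i) * (X 1 j - X 1 i).
apply/eqP => det0.
(* The determinant is a polynomial with rational coefficients. With the points [i], [j], [k] at (0,
   0), (1, 0), (0, 1) its value is 1, so it is not the zero polynomial. *)
have /(congr1 (meval (mxvec (\matrix_(r, c) ((r == 0) && (c == j) || (r == 1)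
  && (c == k))%:R) 0))) : q = 0.
  apply: gen; rewrite -[RHS]det0 /q /X.
  by rewrite !(rmorphB, rmorphM) /= !map_mpolyX !mevalXU !mxvecE.
rewrite /q /X !(rmorphB, rmorphM, rmorph0) /= !mevalXU !mxvecE !mxE /=.
rewrite !eqxx /= (negbTE jk) [k == j]eq_sym (negbTE jk) ![i == _]eq_sym (negbTE
  ji) (negbTE ki).
by rewrite !subr0 mulr1 => /eqP; rewrite oner_eq0.
Qed.

(** * Semidefinite duality *)

Section FrobeniusProduct.

Context (R : realType).

Lemma mxdotC (p q : nat) (A B : 'M[R]_(p, q)) : mxdot A B = mxdot B A.
Proof. by do 2!apply: eq_bigr => ? _; rewrite mulrC. Qed.

Lemma mxdot_trace (p q : nat) (A B : 'M[R]_(p, q)) : mxdot A B = \tr (A^T *m B).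
Proof.
rewrite /mxdot exchange_big; apply: eq_bigr => j _; rewrite mxE.
by apply: eq_bigr => i _; rewrite mxE.
Qed.

Lemma mxdotDl (p q : nat) (A A' B : 'M[R]_(p, q)) :
  mxdot (A + A') B = mxdot A B + mxdot A' B.
Proof.
rewrite /mxdot -big_split; apply: eq_bigr => i _ /=.
by rewrite -big_split; apply: eq_bigr => j _; rewrite mxE mulrDl.
Qed.

Lemma mxdotZl (p q : nat) a (A B : 'M[R]_(p, q)) :
  mxdot (a *: A) B = a * mxdot A B.
Proof.
rewrite /mxdot mulr_sumr; apply: eq_bigr => i _.
by rewrite mulr_sumr; apply: eq_bigr => j _; rewrite mxE mulrA.
Qed.

Lemma mxdotBl (p q : nat) (A A' B : 'M[R]_(p, q)) :
  mxdot (A - A') B = mxdot A B - mxdot A' B.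
Proof. by rewrite mxdotDl -scaleN1r mxdotZl mulN1r. Qed.

Lemma mxdot_suml (p q : nat) (I : Type) (r : seq I) (K : pred I)
    (F : I -> 'M[R]_(p, q)) B :
  mxdot (\sum_(i <- r | K i) F i) B = \sum_(i <- r | K i) mxdot (F i) B.
Proof.
apply: (big_morph (fun A => mxdot A B)) => [A A'|]; first exact: mxdotDl.
by rewrite -[X in mxdot X B](scale0r 0) mxdotZl mul0r.
Qed.

Lemma mxdot_rank1 (p : nat) (v : 'cV[R]_p) (Z : 'M[R]_p) :
  mxdot (v *m v^T) Z = (v^T *m Z *m v) 0 0.
Proof.
rewrite mxE /mxdot exchange_big; apply: eq_bigr => j _.
rewrite mxE mulr_suml; apply: eq_bigr => i _.
by rewrite !mxE big_ord1 !mxE mulrAC.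
Qed.

Lemma mxdot_block (d n : nat) (V : 'M[R]_d) (Z : 'M[R]_(d + n)) :
  mxdot (block_mx V 0 0 0) Z = mxdot V (ulsubmx Z).
Proof.
rewrite /mxdot big_split_ord /= [X in _ + X]big1 ?addr0; last first.
  move=> i _; rewrite big_split_ord /= !big1 ?addr0 // => j _.
    by rewrite block_mxEdr mxE mul0r.
  by rewrite block_mxEdl mxE mul0r.
apply: eq_bigr => i _; rewrite big_split_ord /= [X in _ + X]big1 ?addr0; last first.
  by move=> j _; rewrite block_mxEur mxE mul0r.
by apply: eq_bigr => j _; rewrite block_mxEul !mxE.
Qed.

(** With [w = Z *m v], the form at [v - e *: w] is [e ^+ 2 * b - 2 * e * c], where [c] is the
    squared norm of [w]; for small positive [e] this is negative unless [c = 0]. *)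
Lemma psd_null (N : nat) (Z : 'M[R]_N) (v : 'cV[R]_N) :
  psd Z -> (v^T *m Z *m v) 0 0 = 0 -> Z *m v = 0.
Proof.
move=> [Zsym Z0] v0; pose w := Z *m v.
pose c := (w^T *m w) 0 0; pose b := (w^T *m Z *m w) 0 0.
have cE : c = \sum_i w i 0 ^+ 2.
  by rewrite /c mxE; apply: eq_bigr => i _; rewrite mxE expr2.
have b0 : 0 <= b by apply: Z0.
have quad e : 0 <= e ^+ 2 * b - 2 * e * c.
  have := Z0 (v - e *: w); suff -> : ((v - e *: w)^T *m Z *m (v - e *: w)) 0 0 =
    e ^+ 2 * b - 2 * e * c by [].
  have wv : w^T *m Z *m v = w^T *m w by rewrite -mulmxA.
  have vw : v^T *m Z *m w = w^T *m w by rewrite /w trmx_mul Zsym.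
  have -> : (v - e *: w)^T = v^T - e *: w^T by rewrite linearB linearZ.
  rewrite mulmxBl mulmxBr !mulmxBl -!scalemxAl -!scalemxAr wv vw.
  move: v0; rewrite /b /c; clear.
  move: (v^T *m Z *m v) (w^T *m w) (w^T *m Z *m w) => A B D A0.
  by rewrite !mxE A0; ring.
have c_ge0 : 0 <= c by rewrite cE sumr_ge0 // => i _; apply: sqr_ge0.
have {}c0 : c = 0.
  have b1 : 0 < b + 1 by lra.
  (* Adding 1 to [b] avoids division by zero; the form then takes the value
     [- (e ^+ 2 * (b + 2))]. *)
  have := quad (c / (b + 1)).
  have -> : (c / (b + 1)) ^+ 2 * b - 2 * (c / (b + 1)) * c =
     - ((c / (b + 1)) ^+ 2 * (b + 2)) by field; rewrite gt_eqF.
  rewrite oppr_ge0 => le0.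
  have : (c / (b + 1)) ^+ 2 * (b + 2) == 0.
    by rewrite eq_le le0 mulr_ge0 ?sqr_ge0 //; lra.
  rewrite mulf_eq0 sqrf_eq0 mulf_eq0 invr_eq0 => /orP[/orP[/eqP //|]|] /eqP; lra.
apply/colP => i; rewrite -/w [RHS]mxE; apply/eqP.
move: c0; rewrite cE => /eqP; rewrite psumr_eq0 => [/allP/(_ i)|j _];
  last exact: sqr_ge0.
by rewrite mem_index_enum sqrf_eq0 => /(_ isT).
Qed.

Lemma mxdot_gram_ge0 (N r : nat) (A : 'M[R]_N) (C : 'M[R]_(r, N)) :
  psd A -> 0 <= mxdot A (C^T *m C).
Proof.
move=> [_ A0].
have -> : C^T *m C = \sum_i (row i C)^T *m row i C.
  apply/matrixP => j k; rewrite mxE summxE; apply: eq_bigr => i _.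
  by rewrite !mxE big_ord1 !mxE.
rewrite mxdotC mxdot_suml sumr_ge0 // => i _.
by rewrite -[in X in _ *m X](trmxK (row i C)) mxdot_rank1.
Qed.

End FrobeniusProduct.

Section Duality.

Context (R : realType) (d m n : nat) (G : snl R d m n).

(** Feasibility of [Z] replaces each constraint pairing by its right-hand side, and the identity
    block of [Z] turns the [V] term into [mxdot 1%:M V]. *)
Lemma duality_gap V y w Z : primal_feasible G Z ->
  dual_obj G V y w - primal_obj G Z = mxdot (dual_slack G V y w) Z.
Proof.
move=> [Z1 Zss Zas _]; rewrite /dual_slack !mxdotBl !mxdotDl !mxdot_suml.
rewrite mxdot_block Z1 mxdotC /dual_obj /primal_obj opprD addrA.
congr (_ + _ + _ - _ - _); apply: eq_bigr => -[i j] ij /=; rewrite mxdotZl.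
  by rewrite Zss.
by rewrite Zas.
Qed.

(** Weak duality enters as two hypotheses, one for the given slack and one for the given [Z], so
    that each can be checked with one factor an explicit sum of rank-one matrices. *)
Lemma zero_gap_optimal V y w Z :
  primal_feasible G Z -> dual_feasible G V y w ->
  (forall Z', primal_feasible G Z' -> 0 <= mxdot (dual_slack G V y w) Z') ->
  (forall V' y' w', dual_feasible G V' y' w' ->
    0 <= mxdot (dual_slack G V' y' w') Z) ->
  mxdot (dual_slack G V y w) Z = 0 ->
  [/\ primal_optimal G Z, dual_optimal G V y w
    & forall Z', primal_optimal G Z' -> mxdot (dual_slack G V y w) Z' = 0].
Proof.
move=> pZ dV Z'_ge0 V'_ge0 gap0.
have eq_obj : dual_obj G V y w = primal_obj G Z.
  by apply/eqP; rewrite -subr_eq0 duality_gap // gap0.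
have optZ : primal_optimal G Z.
  split=> // Z' pZ'; rewrite -eq_obj -subr_ge0 duality_gap //.
  exact: Z'_ge0.
split=> //.
  split=> // V' y' w' dV'; rewrite eq_obj -subr_ge0 duality_gap //.
  exact: V'_ge0.
move=> Z' [pZ' optZ']; apply/eqP; rewrite eq_le Z'_ge0 // andbT.
by rewrite -duality_gap // eq_obj subr_le0 optZ' //; case: optZ.
Qed.

End Duality.

(** Reconciles double sums over ordered pairs with the SDP data, which list each sensor pair
    once. *)
Lemma sum_upper_triangle (R : realType) (V : lmodType R) (n : nat)
    (F : 'I_n -> 'I_n -> V) :
  (forall i, F i i = 0) -> (forall i j, F i j = F j i) ->
  \sum_i \sum_j F i j = 2 *: \sum_(ij : 'I_n * 'I_n | (ij.1 < ij.2)%N) F ij.1 ij.2.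
Proof.
move=> F0 FC; rewrite pair_bigA /=.
rewrite (bigID (fun ij : 'I_n * 'I_n => (ij.1 < ij.2)%N)) /= scaler_nat mulr2n.
congr (_ + _); rewrite (bigID (fun ij : 'I_n * 'I_n => ij.1 == ij.2)) /=.
rewrite big1 ?add0r => [|[i j] /andP[_ /eqP /= ->]]; last exact: F0.
rewrite (reindex_inj (h := fun ij => (ij.2, ij.1))) /=; last first.
  by move=> [i j] [i' j'] /= [-> ->].
apply: eq_big => [[i j]|[i j] _] /=; last exact: FC.
by rewrite -leqNgt ltn_neqAle andbC eq_sym -val_eqE.
Qed.

(* A symmetric matrix with zero row sums is a weighted graph Laplacian. *)
Lemma laplacian_decomposition (R : realType) (N q : nat) (W : 'M[R]_N)
    (B : 'M[R]_(N, q)) :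
  W^T = W -> (forall i, \sum_j W i j = 0) ->
  B^T *m W *m B = - 2^-1 *: \sum_i \sum_j
    W i j *: ((row i B - row j B)^T *m (row i B - row j B)).
Proof.
move=> Wsym W1; have WC i j : W i j = W j i by rewrite -{1}Wsym mxE.
apply/matrixP => r c; rewrite !mxE summxE.
have W1' j : \sum_i W i j = 0 by rewrite -[RHS](W1 j); apply: eq_bigr => i _;
  rewrite WC.
(* The square terms drop out because row and column sums vanish; the two mixed terms agree by
   symmetry and cancel the factor one half. *)
have termE i j : (W i j *: ((row i B - row j B)^T *m (row i B - row j B))) r c =
    W i j * (B i r * B i c) + W i j * (B j r * B j c)
    - (B i r * W i j * B j c) - (B j r * W i j * B i c).
  by rewrite !mxE big_ord1 !mxE; ring.
have sumE i : (\sum_j W i j *: ((row i B - row j B)^T *m (row i B - row j B))) r c =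
    \sum_j W i j * (B j r * B j c)
    - \sum_j (B i r * W i j * B j c) - \sum_j (B j r * W i j * B i c).
  rewrite summxE; under eq_bigr do rewrite termE.
  rewrite !sumrB big_split /=.
  by rewrite -mulr_suml W1 mul0r add0r.
under [in RHS]eq_bigr do rewrite sumE.
rewrite !sumrB.
have -> : \sum_i \sum_j W i j * (B j r * B j c) = 0.
  by rewrite exchange_big big1 // => j _; rewrite -mulr_suml W1' mul0r.
have -> : \sum_i \sum_j B j r * W i j * B i c = \sum_i \sum_j B i r * W i j * B j c.
  rewrite exchange_big; apply: eq_bigr => i _; apply: eq_bigr => j _.
  by rewrite WC.
have -> : \sum_j (B^T *m W) r j * B j c = \sum_i \sum_j B i r * W i j * B j c.
  rewrite exchange_big; apply: eq_bigr => j _; rewrite mxE mulr_suml.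
  by apply: eq_bigr => i _; rewrite mxE.
by field.
Qed.

Lemma edist_sqr (R : realType) (d : nat) (u v : 'cV[R]_d) :
  edist u v ^+ 2 = ((u - v)^T *m (u - v)) 0 0.
Proof.
rewrite sqr_sqrtr; last by apply: sumr_ge0 => i _; apply: sqr_ge0.
by rewrite mxE; apply: eq_bigr => i _; rewrite !mxE expr2.
Qed.

Lemma psd_gram (R : realType) (N r : nat) (C : 'M[R]_(r, N)) : psd (C^T *m C).
Proof.
split; first by rewrite trmx_mul trmxK.
move=> v; rewrite mulmxA -mulmxA -trmx_mul mxE sumr_ge0 // => i _.
by rewrite mxE -expr2 sqr_ge0.
Qed.

(** * The dual certificate *)

Section Localization.

Context (R : realType) (m n : nat) (a : 'M[R]_(2, m)) (x : 'M[R]_(2, n)).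
Context (T : {set {set 'I_(m + n)}}).
Context (anchors_ge3 : (3 <= m)%N) (Hgeneric : generic (row_mx a x)).
Context (Htri : is_triangulation (row_mx a x) T).

Local Notation p := (row_mx a x).
Local Notation G := (triangulation_snl a x T).
Local Notation W := (stress_mx p T).

(* Row [lshift n k] is [(a_k; 0)] and row [rshift m j] is [(0; e_j)], so that
   differences of rows are the vectors defining the SDP data matrices. *)
Definition node_mx : 'M[R]_(m + n, 2 + n) := block_mx a^T 0 0 1%:M.

Definition location_mx : 'M[R]_(2, 2 + n) := row_mx 1%:M x.

Local Notation B := node_mx.
Local Notation C := location_mx.

Definition slack_mx : 'M[R]_(2 + n) := B^T *m W *m B.

Lemma location_node : C *m B^T = p.
Proof.
rewrite /C /B tr_block_mx mul_row_block trmxK !trmx0 trmx1.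
by rewrite !mul1mx !mulmx1 mulmx0 addr0 add0r.
Qed.

(** A nonzero [c] would be normal to a line through all anchors, but genericity makes three of them
    noncollinear. By Cramer's rule, the determinant [D] annihilates both entries of [c]. *)
Lemma noncollinear_anchors (b : R) (c : 'cV[R]_2) :
  (forall k, a 0 k * c 0 0 + a 1 k * c 1 0 = b) -> c = 0.
Proof.
move=> cb; have m0 : (0 < m)%N by apply: leq_trans anchors_ge3.
have m1 : (1 < m)%N by apply: leq_trans anchors_ge3.
have := @generic_noncollinear R _ p (lshift n (Ordinal m0))
  (lshift n (Ordinal m1)) (lshift n (Ordinal anchors_ge3)) Hgeneric isT isT isT.
rewrite !row_mxEl; have := cb (Ordinal m0); have := cb (Ordinal m1).
have := cb (Ordinal anchors_ge3).
set a00 := a 0 (Ordinal m0); set a10 := a 1 (Ordinal m0).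
set a01 := a 0 (Ordinal m1); set a11 := a 1 (Ordinal m1).
set a02 := a 0 (Ordinal anchors_ge3); set a12 := a 1 (Ordinal anchors_ge3).
set D := (X in X != 0).
move=> e2 e1 e0 D0; apply/colP => r; rewrite mxE.
have c0 : D * c 0 0 = 0.
  transitivity ((a12 - a10) * (a01 * c 0 0 + a11 * c 1 0 - (a00 * c 0 0 + a10 *
    c 1 0))
    - (a11 - a10) * (a02 * c 0 0 + a12 * c 1 0 - (a00 * c 0 0 + a10 * c 1 0)));
      first by rewrite /D; ring.
  by rewrite e0 e1 e2; ring.
have c1 : D * c 1 0 = 0.
  transitivity ((a01 - a00) * (a02 * c 0 0 + a12 * c 1 0 - (a00 * c 0 0 + a10 *
    c 1 0))
    - (a02 - a00) * (a01 * c 0 0 + a11 * c 1 0 - (a00 * c 0 0 + a10 * c 1 0)));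
      first by rewrite /D; ring.
  by rewrite e0 e1 e2; ring.
case: r => [[|[|//]]] lt_r.
  move/eqP: c0; rewrite mulf_eq0 (negbTE D0) /= => /eqP <-.
  by congr (c _ _); apply: val_inj.
move/eqP: c1; rewrite mulf_eq0 (negbTE D0) /= => /eqP <-.
by congr (c _ _); apply: val_inj.
Qed.

(** By [stress_kernel], the entries of [B *m u^T] are the values of an affine function at all
    points. At the anchors they agree with the linear function given by [lsubmx u]; noncollinearity
    forces the two functions to coincide, which determines the sensor entries. *)
Lemma stress_kernel_location (u : 'rV[R]_(2 + n)) :
  (forall s t, s \in T -> t \in T -> tri_adjacent s t ->
     stress p s t *m (B *m u^T) = 0) ->
  u = lsubmx u *m C.
Proof.
move=> /(stress_kernel Htri)[c]; rewrite -[c]vsubmxK -[u]hsubmxK row_mxKl.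
move: (usubmx c) (dsubmx c) (lsubmx u) (rsubmx u) => b {}c g h.
rewrite tr_row_mx /B mul_block_col !mul0mx addr0 add0r mul1mx /lift_mx.
rewrite mul_row_col tr_row_mx -col_mx_const mul_col_mx mul_col_mx add_col_mx.
move=> /eq_col_mx[top bottom].
have c_g : c = g^T.
  apply/eqP; rewrite eq_sym -subr_eq0; apply/eqP.
  apply: (@noncollinear_anchors (b 0 0)) => k.
  move/colP/(_ k): top; rewrite !mxE !big_ord_recl !big_ord0 !mxE.
  rewrite (_ : lift ord0 ord0 = 1); last exact: val_inj.
  by move: (a 0 k) (a 1 k) => a0 a1; rewrite (_ : ord0 = 0) //; lra.
have b0 : b = 0.
  apply/matrixP => i j; rewrite !ord1 mxE.
  move: top; rewrite c_g => /eqP;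
    rewrite -subr_eq0 opprD addrCA subrr addr0 oppr_eq0.
  have m0 : (0 < m)%N by apply: leq_trans anchors_ge3.
  by move=> /eqP/colP/(_ (Ordinal m0)); rewrite !mxE big_ord1 mxE mul1r.
move: bottom; rewrite b0 mulmx0 add0r c_g => hE.
by rewrite /C mul_mx_row mulmx1; congr row_mx; apply: trmx_inj; rewrite trmx_mul.
Qed.

Lemma stress_mx_location : W *m p^T = 0.
Proof.
have := stress_mx_lift Htri; rewrite /lift_mx mul_mx_row -row_mx0.
by move=> /eq_row_mx[].
Qed.

Lemma stress_mx_row_sum i : \sum_j W i j = 0.
Proof.
have := stress_mx_lift Htri; rewrite /lift_mx mul_mx_row -row_mx0.
move=> /eq_row_mx[/colP/(_ i) + _]; rewrite mxE [RHS]mxE => W1; rewrite -[RHS]W1.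
by apply: eq_bigr => j _; rewrite [const_mx _ _ _]mxE mulr1.
Qed.

Lemma slack_location : slack_mx *m C^T = 0.
Proof.
by rewrite /slack_mx -mulmxA -[B *m C^T]trmxK trmx_mul trmxK location_node
  -mulmxA stress_mx_location mulmx0.
Qed.

Lemma slack_mxE : slack_mx = \sum_(st | adjacent_pair T st)
  weight p T st *: ((stress p st.1 st.2 *m B)^T *m (stress p st.1 st.2 *m B)).
Proof.
rewrite /slack_mx /stress_mx mulmx_sumr mulmx_suml; apply: eq_bigr => st _.
by rewrite -scalemxAr -scalemxAl trmx_mul !mulmxA.
Qed.

Lemma mxdot_slack Z : mxdot slack_mx Z = \sum_(st | adjacent_pair T st)
  weight p T st * ((stress p st.1 st.2 *m B) *m Z *m (stress p st.1 st.2 *m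
    B)^T) 0 0.
Proof.
rewrite slack_mxE mxdot_suml; apply: eq_bigr => st _; rewrite mxdotZl.
by rewrite -{2}[_ *m B]trmxK mxdot_rank1 trmxK.
Qed.

Lemma mxdot_slack_ge0 Z : psd Z -> 0 <= mxdot slack_mx Z.
Proof.
move=> [_ Z0]; rewrite mxdot_slack sumr_ge0 // => st adj.
rewrite mulr_ge0 ?(ltW (weight_gt0 Htri adj)) //.
by rewrite -{1}[_ *m B]trmxK Z0.
Qed.

Lemma mxdot_slack_stress Z s t : psd Z -> mxdot slack_mx Z = 0 ->
  s \in T -> t \in T -> tri_adjacent s t ->
  ((stress p s t *m B) *m Z *m (stress p s t *m B)^T) 0 0 = 0.
Proof.
move=> [_ Z0]; rewrite mxdot_slack => /eqP.
rewrite psumr_eq0 => [/allP sum0 sT tT st|st adj]; last first.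
  rewrite mulr_ge0 ?(ltW (weight_gt0 Htri adj)) //.
  by rewrite -{1}[_ *m B]trmxK Z0.
have adj : adjacent_pair T (s, t) by apply/and3P.
have /implyP/(_ adj) := sum0 (s, t) (mem_index_enum _).
by rewrite mulf_eq0 (gt_eqF (weight_gt0 Htri adj)) /= => /eqP.
Qed.

(** All stress pairings with [Z] vanish, so by [psd_null] the rows of [Z] are orthogonal to every
    [stress p s t *m B]. *)
Lemma mxdot_slack_null Z : psd Z -> mxdot slack_mx Z = 0 -> Z = lsubmx Z *m C.
Proof.
move=> psdZ Z0; apply/row_matrixP => i; rewrite row_mul.
have -> : row i (lsubmx Z) = lsubmx (row i Z) by apply/rowP => j; rewrite !mxE.
apply: stress_kernel_location => s t sT tT st.
have := mxdot_slack_stress psdZ Z0 sT tT st; rewrite -{1}[_ *m B]trmxK.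
move=> /(psd_null psdZ)/(congr1 (row i)); rewrite row_mul row0 => Zi0.
by apply: trmx_inj; rewrite mulmxA trmx_mul trmxK Zi0 trmx0.
Qed.

Lemma slack_psd : psd slack_mx.
Proof.
split; first by rewrite /slack_mx !trmx_mul trmxK stress_mx_sym mulmxA.
move=> v; rewrite -mxdot_rank1 mxdotC -{1}[v]trmxK.
by apply: mxdot_slack_ge0; apply: psd_gram.
Qed.

Lemma rank_location : \rank C = 2%N.
Proof.
apply/eqP; apply/row_freeP; exists (col_mx 1%:M 0).
by rewrite mul_row_col mulmx1 mulmx0 addr0.
Qed.

Lemma slack_null (u : 'rV[R]_(2 + n)) : u *m slack_mx = 0 -> u = lsubmx u *m C.
Proof.
move=> u0; apply: stress_kernel_location => s t sT tT st.
have gap0 : mxdot slack_mx (u^T *m u) = 0.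
  by rewrite mxdotC -{2}[u]trmxK mxdot_rank1 trmxK u0 mul0mx mxE.
have := mxdot_slack_stress (psd_gram u) gap0 sT tT st.
have -> : stress p s t *m B *m (u^T *m u) *m (stress p s t *m B)^T =
    (stress p s t *m (B *m u^T)) *m (stress p s t *m (B *m u^T))^T.
  by rewrite !trmx_mul trmxK !mulmxA.
set e := stress p s t *m (B *m u^T).
rewrite mxE big_ord1 [e^T _ _]mxE => /eqP; rewrite mulf_eq0 orbb => /eqP e0.
by apply/matrixP => i j; rewrite !ord1 e0 mxE.
Qed.

Lemma rank_slack : \rank slack_mx = n.
Proof.
have kerE : (kermx slack_mx :=: C)%MS.
  apply/eqmxP/andP; split.
    apply/row_subP => i; have /slack_null -> :
      row i (kermx slack_mx) *m slack_mx = 0.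
      by rewrite -row_mul mulmx_ker row0.
    exact: submxMl.
  apply/sub_kermxP; apply: trmx_inj; rewrite trmx_mul trmx0.
  by case: slack_psd => -> _; apply: slack_location.
have := mxrank_ker slack_mx; rewrite kerE rank_location => /esym/eqP.
have := rank_leq_row slack_mx; lia.
Qed.

(** The off-diagonal pattern of [W] is what a dual slack allows: free at edges, 1 at virtual edges,
    0 elsewhere. *)
Lemma edge_virtual_split (V : lmodType R) i j (F : V) : i != j ->
  - W i j *: F =
  (if tri_edge T i j then - W i j *: F else 0)
  - (if virtual_edge T i j then F else 0).
Proof.
move=> ij; case: ifPn => [eij|neij].
  by rewrite /virtual_edge eij andbF subr0.
have [vij|nvij] := boolP (virtual_edge T i j).
  by rewrite (stress_mx_virtual Htri vij) sub0r scaleN1r.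
by rewrite stress_mx_nonedge // oppr0 scale0r subr0.
Qed.

(** Anchor-anchor terms of the Laplacian live in the upper-left block, where the multiplier [V]
    absorbs them whether or not the anchors are joined. *)
Definition dual_V : 'M[R]_2 := - 2^-1 *: \sum_k \sum_k'
  W (lshift n k) (lshift n k') *: ((col k a - col k' a) *m (col k a - col k' a)^T).

Definition dual_y : 'M[R]_n := \matrix_(i, j) - W (rshift m i) (rshift m j).

Definition dual_w : 'M[R]_(m, n) := \matrix_(k, j) - W (lshift n k) (rshift m j).

Lemma dual_V_sym : dual_V^T = dual_V.
Proof.
rewrite /dual_V linearZ; congr (_ *: _); rewrite linear_sum; apply: eq_bigr => k _.
rewrite linear_sum; apply: eq_bigr => k' _ /=.
by rewrite linearZ /= trmx_mul trmxK.
Qed.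

Lemma node_anchor k : row (lshift n k) B = row_mx (col k a)^T 0.
Proof.
by rewrite /B /block_mx rowKu row_row_mx row0 tr_col.
Qed.

Lemma node_sensor j : row (rshift m j) B = row_mx 0 (delta_mx 0 j).
Proof. by rewrite /B /block_mx rowKd row_row_mx row0 row1. Qed.

Lemma node_anchor_sensor k j :
  row (lshift n k) B - row (rshift m j) B = (as_vec a k j)^T.
Proof.
rewrite node_anchor node_sensor opp_row_mx add_row_mx subr0 sub0r.
by rewrite /as_vec tr_col_mx linearN /= trmx_delta.
Qed.

Lemma node_sensor_sensor i j :
  row (rshift m i) B - row (rshift m j) B = (ss_vec R 2 i j)^T.
Proof.
rewrite !node_sensor opp_row_mx add_row_mx subr0.
by rewrite /ss_vec tr_col_mx linearB /= !trmx_delta trmx0.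
Qed.

Lemma node_anchor_anchor k k' :
  row (lshift n k) B - row (lshift n k') B = row_mx (col k a - col k' a)^T 0.
Proof. by rewrite !node_anchor opp_row_mx add_row_mx subr0 linearB. Qed.

Lemma dual_slack_slack_mx : dual_slack G dual_V dual_y dual_w = slack_mx.
Proof.
rewrite /slack_mx (laplacian_decomposition _ (stress_mx_sym p T) stress_mx_row_sum).
set F := fun i j => W i j *: ((row i B - row j B)^T *m (row i B - row j B)).
have WC i j : W i j = W j i by rewrite -{1}(stress_mx_sym p T) mxE.
have FC i j : F i j = F j i.
  by rewrite /F WC -opprB [(- _)^T]linearN /= mulNmx mulmxN opprK.
have F0 i : F i i = 0 by rewrite /F subrr mulmx0 scaler0.
(* Mixed pairs occur in both orders and sensor pairs are restricted to [i < j], which cancels the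
   factor one half; anchor pairs keep it, as in [dual_V]. *)
transitivity (- 2^-1 *: (\sum_k \sum_k' F (lshift n k) (lshift n k'))
  - \sum_(kj : 'I_m * 'I_n) F (lshift n kj.1) (rshift m kj.2)
  - \sum_(ij : 'I_n * 'I_n | (ij.1 < ij.2)%N) F (rshift m ij.1) (rshift m ij.2));
  last first.
  transitivity (- 2^-1 *: \sum_i \sum_j F i j) => //.
  rewrite [in RHS]big_split_ord /=.
  under [X in _ = _ *: (X + _)]eq_bigr do rewrite big_split_ord /=.
  under [X in _ = _ *: (_ + X)]eq_bigr do rewrite big_split_ord /=.
  rewrite !big_split /=.
  rewrite (@sum_upper_triangle R _ n (fun i j => F (rshift m i) (rshift m j))) //.
  have -> : \sum_i \sum_j F (rshift m i) (lshift n j) =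
      \sum_i \sum_j F (lshift n i) (rshift m j).
    by rewrite exchange_big; do 2!apply: eq_bigr => ? _.
  rewrite -(pair_bigA _ (fun k j =>
    F (lshift n k) (rshift m j))) /= -[in RHS]addrA [X in _ =
      _ *: (_ + X)]addrA -mulr2n -scaler_nat.
  rewrite -scalerDr (scalerDr (- 2^-1)) [in RHS]scalerA mulNr mulVf ?pnatr_eq0 //.
  by rewrite scaleN1r opprD addrA.
have EV : block_mx dual_V 0 0 0 =
    - 2^-1 *: \sum_k \sum_k' F (lshift n k) (lshift n k') :> 'M[R]_(2 + n).
  pose J : 'M[R]_(2, 2 + n) := row_mx 1%:M 0.
  have -> : block_mx dual_V 0 0 0 = J^T *m dual_V *m J.
    rewrite /J tr_row_mx trmx1 trmx0 mul_col_mx mul1mx mul0mx mul_col_mx.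
    by rewrite !mul_mx_row !mulmx0 mulmx1 mul0mx.
  rewrite /dual_V -scalemxAr -scalemxAl; congr (_ *: _).
  rewrite mulmx_sumr mulmx_suml; apply: eq_bigr => k _.
  rewrite mulmx_sumr mulmx_suml; apply: eq_bigr => k' _.
  rewrite -scalemxAr -scalemxAl /F node_anchor_anchor; congr (_ *: _).
  have -> : row_mx (col k a - col k' a)^T 0 = (col k a - col k' a)^T *m J.
    by rewrite mul_mx_row mulmx1 mulmx0.
  by rewrite trmx_mul trmxK !mulmxA.
have Eas : - \sum_(kj : 'I_m * 'I_n) F (lshift n kj.1) (rshift m kj.2) =
    \sum_(kj in as_edges G) dual_w kj.1 kj.2 *: as_mx a kj.1 kj.2
    - \sum_(kj in as_virtual G) as_mx a kj.1 kj.2.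
  rewrite -sumrN [X in _ = X - _]big_mkcond [X in _ = _ - X]big_mkcond -sumrB.
  apply: eq_bigr => -[k j] _; rewrite /F node_anchor_sensor trmxK -scaleNr.
  rewrite edge_virtual_split ?eq_lrshift //=.
  by rewrite !inE /= mxE.
have Ess : - \sum_(ij :
  'I_n * 'I_n | (ij.1 < ij.2)%N) F (rshift m ij.1) (rshift m ij.2) =
    \sum_(ij in ss_edges G) dual_y ij.1 ij.2 *: ss_mx R 2 ij.1 ij.2
    - \sum_(ij in ss_virtual G) ss_mx R 2 ij.1 ij.2.
  rewrite -sumrN [LHS]big_mkcond [X in _ = X - _]big_mkcond.
  rewrite [X in _ = _ - X]big_mkcond -sumrB.
  apply: eq_bigr => -[i j] _; rewrite /F node_sensor_sensor trmxK -scaleNr !inE /=.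
  have [ij|] := boolP (i < j)%N; last by rewrite subr0.
  rewrite edge_virtual_split //=; last by rewrite eq_rshift -val_eqE neq_ltn ij.
  by rewrite mxE.
rewrite Eas Ess -EV /dual_slack /=; clear.
set e1 := \sum_(ij in _) _; set e2 := \sum_(kj in _) _.
by rewrite !addrA (addrAC _ e1) (addrAC _ e1).
Qed.

Lemma location_as k j : C *m as_vec a k j = col k a - col j x.
Proof. by rewrite /C mul_row_col mul1mx mulmxN -colE. Qed.

Lemma location_ss i j : C *m ss_vec R 2 i j = col i x - col j x.
Proof. by rewrite /C mul_row_col mulmx0 add0r mulmxBr -!colE. Qed.

Lemma mxdot_rank1_gram (v : 'cV[R]_(2 + n)) :
  mxdot (v *m v^T) (C^T *m C) = ((C *m v)^T *m (C *m v)) 0 0.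
Proof. by rewrite mxdot_rank1 trmx_mul !mulmxA. Qed.

Lemma location_gram : C^T *m C = block_mx 1%:M x x^T (x^T *m x).
Proof.
rewrite /C tr_row_mx trmx1 mul_col_mx !mul_mx_row !mul1mx !mulmx1.
by [].
Qed.

Lemma location_feasible : primal_feasible G (C^T *m C).
Proof.
split; last exact: psd_gram.
- by rewrite location_gram block_mxKul.
- by move=> i j _; rewrite mxdot_rank1_gram location_ss edist_sqr.
- by move=> k j _; rewrite mxdot_rank1_gram location_as edist_sqr.
Qed.

(** The identity block turns the top rows of [lsubmx Z *m C] into [C]; symmetry then gives the left
    columns. *)
Lemma location_determined Z : primal_feasible G Z -> Z = lsubmx Z *m C -> Z =
  C^T *m C.
Proof.
move=> [Z1 _ _ [Zsym _]] ZC; suff ZCt : lsubmx Z = C^T by rewrite {1}ZC ZCt.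
have ulZ : usubmx (lsubmx Z) = 1%:M by rewrite -Z1; apply/matrixP => i j;
  rewrite !mxE.
have uZ : usubmx Z = C.
  by rewrite {1}ZC -[X in X *m _]vsubmxK mul_col_mx col_mxKu ulZ mul1mx.
have dlZ : dsubmx (lsubmx Z) = x^T.
  transitivity (dlsubmx Z); first by apply/matrixP => i j; rewrite !mxE.
  by rewrite -[in LHS]Zsym -trmx_ursub /ursubmx uZ row_mxKr.
by rewrite -[LHS]vsubmxK ulZ dlZ /C tr_row_mx trmx1.
Qed.

End Localization.

Theorem theorem3 (R : realType) (m n : nat)
    (a : 'M[R]_(2, m)) (x : 'M[R]_(2, n)) (T : {set {set 'I_(m + n)}})
    (anchors_ge3 : (3 <= m)%N)
    (Hgeneric : generic (row_mx a x))
    (Htri : is_triangulation (row_mx a x) T) :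
  let G := triangulation_snl a x T in
  exists (U Z : 'M[R]_(2 + n)),
    [/\ dual_optimal_slack G U /\ \rank U = n,
        primal_optimal G Z /\ (forall Z', primal_optimal G Z' -> Z' = Z),
        \rank Z = 2%N,
        strictly_complementary G Z U
      & Z = block_mx 1%:M x x^T (x^T *m x)].
Proof.
move=> G; pose C := location_mx x; pose U := slack_mx a x T.
have slackE := dual_slack_slack_mx Htri.
have UC0 : U *m C^T = 0 by apply: slack_location.
have rankU : \rank U = n by apply: rank_slack.
have rankZ : \rank (C^T *m C) = 2%N.
  by rewrite mxrankMfree ?mxrank_tr ?rank_location // -row_leq_rank rank_location.
have [|||||optZ optU optZ'] := @zero_gap_optimal R 2 m n G
  (dual_V a x T) (dual_y a x T) (dual_w a x T) (C^T *m C).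
- exact: location_feasible.
- by split; [exact: dual_V_sym|rewrite slackE; apply: slack_psd].
- by move=> Z' [_ _ _ psdZ']; rewrite slackE; apply: mxdot_slack_ge0.
- by move=> V' y' w' [_ psdU']; apply: mxdot_gram_ge0.
- have [Usym _] := slack_psd Htri.
  by rewrite slackE mxdot_trace Usym mulmxA UC0 mul0mx mxtrace0.
have dualU : dual_optimal_slack G U.
  by exists (dual_V a x T), (dual_y a x T), (dual_w a x T); rewrite slackE.
have ZU0 : C^T *m C *m U = 0.
  rewrite -mulmxA; apply: trmx_inj; rewrite 2!trmx_mul trmxK.
  by have [-> _] := slack_psd Htri; rewrite UC0 mul0mx trmx0.
exists U, (C^T *m C); split=> //.
(* An optimal [Z'] has zero pairing with the slack, hence the form [lsubmx Z' *m C], and feasibility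
   leaves only one such matrix. *)
- split=> // Z' optZ1; have [pZ' _] := optZ1; apply: (location_determined pZ').
  have [_ _ _ psdZ'] := pZ'.
  by apply: (mxdot_slack_null anchors_ge3 Hgeneric Htri psdZ'); rewrite -slackE optZ'.
- by split=> //; rewrite rankZ rankU.
- exact: location_gram.
Qed.
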